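(* Let $G=(V,E)$ be a finite connected graph with $n=|V|$ vertices, $m=|E|\ge 1$ edges and maximum degree $\Delta$. Let $0<\beta<\infty$ be the inverse temperature of the zero-field ferromagnetic Ising model on $G$, and let $x=\tanh\beta$. Then the corresponding worm process, i.e. the Markov chain on $\mathcal{W}$ with transition matrix $P_x$ (defined in the context), satisfies $$t_{\mathrm{rel}}\le 4\,\Delta\,m\,n^4,$$ and for any $\delta\in(0,1)$, $$t_{\mathrm{mix}}(\mathbf{0},\delta)\le 4\left[\log 2+\frac{\log\delta^{-1}}{m}\right]\Delta\,m^2\,n^4,$$ $$t_{\mathrm{mix}}(\delta)\le 4\left[\log\left(\frac{2}{x}\right)+\frac{\log 2\delta^{-1}}{m}\right]\Delta\,m^2\,n^4,$$ where $\log 2\delta^{-1}=\log(2/\delta)$.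
   Context: Graphs are simple and undirected; $d(v)$ denotes the degree of $v$ in $G$. For $A\subseteq E$, $\partial A\subseteq V$ denotes the set of vertices of odd degree in the spanning subgraph $(V,A)$. Let $\mathcal{C}_0=\{A\subseteq E:\partial A=\emptyset\}$, $\mathcal{C}_2=\{A\subseteq E:|\partial A|=2\}$, and $\mathcal{W}=\mathcal{C}_0\cup\mathcal{C}_2$. The empty edge set, viewed as an element of $\mathcal{W}$, is denoted $\mathbf{0}$. $\triangle$ denotes symmetric difference; for an edge $uv$, $A\triangle uv$ means $A\triangle\{uv\}$. $\mathbf{1}(\cdot)$ is the indicator. For $S\subseteq 2^E$ let $\lambda_x(S)=\sum_{A\in S}x^{|A|}$. The Prokof'ev-Svistunov (PS) measure is the probability measure on $\mathcal{W}$ given by $$\pi_x(A)=\frac{x^{|A|}\psi(A)}{n\lambda_x(\mathcal{C}_0)+2\lambda_x(\mathcal{C}_2)},\qquad \psi(A)=n \text{ if }A\in\mathcal{C}_0,\quad \psi(A)=2\text{ if }A\in\mathcal{C}_2.$$ The worm process has state space $\mathcal{W}$ and transition matrix $P_x$ whose off-diagonal entries are, for an edge $uv\in E$ and $A,\,A\triangle uv\in\mathcal{W}$: (i) if $A\in\mathcal{C}_0$: $P_x(A,A\triangle uv)=x^{\mathbf{1}(uv\notin A)}\frac{1}{2n}\left(\frac1{d(u)}+\frac1{d(v)}\right)$; (ii) if $A\triangle uv\in\mathcal{C}_0$: $P_x(A,A\triangle uv)=x^{\mathbf{1}(uv\notin A)}\frac14\left(\frac1{d(u)}+\frac1{d(v)}\right)$;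 (iii) if $A\in\mathcal{C}_2$, $A\triangle uv\in\mathcal{C}_2$ and $u\in\partial A$: $P_x(A,A\triangle uv)=\min\left(\frac{d(u)}{d(v)}x^{\mathbf{1}(uv\notin A)-\mathbf{1}(uv\in A)},1\right)\frac{1}{4d(u)}$. All other off-diagonal entries are zero, and the diagonal entries are determined by the rows summing to 1. The chain is lazy and reversible with respect to $\pi_x$. For an aperiodic irreducible reversible finite chain with transition matrix $P$ and stationary distribution $\pi$ on $\Omega$: $t_{\mathrm{rel}}=1/(1-\lambda_\star)$, where $\lambda_\star$ is the maximum absolute value of the non-trivial eigenvalues of $P$ (those other than the simple eigenvalue 1); $t_{\mathrm{mix}}(\omega,\delta)=\min\{t\in\mathbb{N}:\|P^t(\omega,\cdot)-\pi\|\le\delta\}$ with $\|\cdot\|$ total variation distance; and $t_{\mathrm{mix}}(\delta)=\max_{\omega\in\Omega}t_{\mathrm{mix}}(\omega,\delta)$. *)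

(* Defs.v *)
From HB Require Import structures.
From mathcomp Require Import all_boot all_order all_algebra.
From mathcomp Require Import complex.
From mathcomp Require Import all_classical all_reals all_analysis.

Set Implicit Arguments.
Unset Strict Implicit.
Unset Printing Implicit Defensive.

Import Order.TTheory GRing.Theory Num.Theory.
Local Open Scope ring_scope.

Definition tanh (R : realType) (b : R) : R :=
  (expR b - expR (- b)) / (expR b + expR (- b)).

Section FiniteChain.
Variables (R : realType) (T : finType).
Implicit Types (P : T -> T -> R) (p q pi : T -> R).

Definition chain_mx P : 'M[R]_#|T| :=
  \matrix_(i, j) P (enum_val i) (enum_val j).

Definition chain_iter P (t : nat) (s s' : T) : R :=
  (chain_mx P ^+ t) (enum_rank s) (enum_rank s').

Definition tv_dist p q : R :=
  \big[Num.max/0]_(S : {set T}) `|\sum_(s in S) p s - \sum_(s in S) q s|.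

(* [\rank] of the eigenspace is the geometric multiplicity; reversible
   transition matrices are diagonalizable, so it is the algebraic one too.
   The value 1 is discarded only when it is a simple eigenvalue, so that a
   reducible chain gets [lambda_star = 1]. *)
Definition nontrivial_eigenvalue P (a : R[i]) : bool :=
  let M := map_mx (real_complex R) (chain_mx P) in
  eigenvalue M a && ~~ ((a == 1) && (\rank (eigenspace M 1) == 1)%N).

Definition lambda_star P : R :=
  sup [set ComplexField.Normc.normc a
      | a in [set a | nontrivial_eigenvalue P a]]%classic.

(* The inverse is taken in [\bar R], where [0^-1 = +oo]. *)
Definition trel P : \bar R := ((1 - lambda_star P)%:E^-1)%E.

(* The infimum of a set of naturals is its minimum, and is [+oo] if the set is
   empty. *)
Definition tmix_from P pi (s : T) (delta : R) : \bar R :=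
  ereal_inf [set (t%:R)%:E | t in
    [set t : nat | tv_dist (chain_iter P t s) pi <= delta]]%classic.

Definition tmix P pi (delta : R) : \bar R :=
  \big[maxe/0%E]_(s : T) tmix_from P pi s delta.

End FiniteChain.

Section Worm.
(* Undoes the shadowing of names such as [set0] by [classical_sets]. *)
Import mathcomp.boot.finset.
Local Open Scope set_scope.
(* The edge [uv] of the graph with adjacency relation [e] is [[set u; v]]. *)
Variables (V : finType) (e : rel V).
Implicit Types (A B : {set {set V}}) (u v w : V).

Definition edges : {set {set V}} :=
  [set [set uv.1; uv.2] | uv : V * V & e uv.1 uv.2].

Definition deg v : nat := #|[set w | e v w]|.

Definition max_deg : nat := \max_v deg v.

Definition boundary A : {set V} := [set v | odd #|[set f in A | v \in f]|].

Definition C0 : {set {set {set V}}} :=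
  [set A in powerset edges | boundary A == set0].

Definition C2 : {set {set {set V}}} :=
  [set A in powerset edges | #|boundary A| == 2].

Definition worm_config : {set {set {set V}}} := C0 :|: C2.

Definition flip A u v : {set {set V}} :=
  (A :\: [set [set u; v]]) :|: ([set [set u; v]] :\: A).

Lemma flip_inj A u v u' v' :
  flip A u v = flip A u' v' -> [set u; v] = [set u'; v'].
Proof.
move=> /setP /(_ [set u; v]); rewrite !in_setU !in_setD !in_set1 eqxx /=.
by case: (_ \in A); case: eqP.
Qed.

Lemma boundary_flip A u v w :
  (w \in boundary (flip A u v)) = (w \in boundary A) (+) (w \in [set u; v]).
Proof.
have memB C : (w \in boundary C) = odd #|[set f in C | w \in f]|.
  by rewrite in_set.
rewrite !memB; set f0 := [set u; v].
set Aw := [set f in A | w \in f].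
have memAw f : (f \in Aw) = (f \in A) && (w \in f) by rewrite in_set.
have memBw f : (f \in [set f in flip A u v | w \in f])
    = ((f \in A) (+) (f == f0)) && (w \in f).
  rewrite in_set in_setU !in_setD in_set1 -/f0.
  by case: (f \in A); case: (f == f0).
have [wf0|wf0] := boolP (w \in f0).
- have [f0A|f0A] := boolP (f0 \in A).
  + rewrite (_ : [set _ in _ | _] = Aw :\ f0).
      by rewrite (cardsD1 f0 Aw) memAw f0A wf0 addbT /= negbK.
    apply/setP => f; rewrite memBw in_setD1 memAw.
    by case: (eqVneq f f0) => [->|_]; rewrite ?f0A ?addbF.
  + rewrite (_ : [set _ in _ | _] = f0 |: Aw).
      by rewrite cardsU1 memAw (negPf f0A) addbT.
    apply/setP => f; rewrite memBw in_setU1 memAw.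
    by case: (eqVneq f f0) => [->|_]; rewrite ?(negPf f0A) ?wf0 ?addbF.
- rewrite addbF; congr (odd #|pred_of_set _|); apply/setP => f.
  rewrite memBw memAw.
  by case: (eqVneq f f0) => [->|_]; rewrite ?(negPf wf0) ?andbF ?addbF.
Qed.

Definition worm_state : finType := {A : {set {set V}} | A \in worm_config}.

Lemma set0_worm_config : set0 \in worm_config.
Proof.
suff b0 : boundary set0 = set0 by rewrite !inE sub0set b0 eqxx.
apply/setP => v; rewrite !inE (_ : [set _ in _ | _] = set0) ?cards0 //.
by apply/setP => f; rewrite !inE.
Qed.

Definition worm0 : worm_state := exist _ set0 set0_worm_config.

Section Weights.
Variables (R : realType) (x : R).

Definition lambda_ (S : {set {set {set V}}}) : R := \sum_(A in S) x ^+ #|A|.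

Definition psi A : R := if A \in C0 then #|V|%:R else 2.

Definition ps_measure (A : worm_state) : R :=
  x ^+ #|val A| * psi (val A) / (#|V|%:R * lambda_ C0 + 2 * lambda_ C2).

Definition worm_rate A u v : R :=
  let B := flip A u v in
  if A \in C0 then
    x ^+ ([set u; v] \notin A) * (1 / (2 * #|V|%:R))
      * (1 / (deg u)%:R + 1 / (deg v)%:R)
  else if B \in C0 then
    x ^+ ([set u; v] \notin A) * (1 / 4) * (1 / (deg u)%:R + 1 / (deg v)%:R)
  else
    Num.min ((deg u)%:R / (deg v)%:R
      * x ^ (([set u; v] \notin A)%:Z - ([set u; v] \in A)%:Z)) 1
      * (1 / (4 * (deg u)%:R)).

(* [pick] chooses an orientation [(u, v)] of the edge along which [A] and [B]
   differ. It is forced by [u \in boundary A] when both are in [C2], and is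
   irrelevant otherwise, the rate being symmetric in [u] and [v]. *)
Definition worm_offdiag A B : R :=
  if [pick uv : V * V | [&& e uv.1 uv.2, B == flip A uv.1 uv.2
        & (A \in C2) && (B \in C2) ==> (uv.1 \in boundary A)]] is Some (u, v)
  then worm_rate A u v else 0.

Definition worm_P (A B : worm_state) : R :=
  if A == B then 1 - \sum_(C : worm_state | C != A) worm_offdiag (val A) (val C)
  else worm_offdiag (val A) (val B).

Lemma worm_P_sum (A : worm_state) : \sum_B worm_P A B = 1.
Proof.
rewrite (bigD1 A) //= {1}/worm_P eqxx -[RHS](subrK (\sum_(C : worm_state | C != A)
  worm_offdiag (val A) (val C))); congr (_ + _).
by apply: eq_bigr => B nBA; rewrite /worm_P eq_sym (negPf nBA).
Qed.

Lemma worm_P_eq0 (A B : worm_state) : A != B ->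
  (forall u v, e u v -> val B != flip (val A) u v) -> worm_P A B = 0.
Proof.
move=> nAB h; rewrite /worm_P (negPf nAB) /worm_offdiag.
case: pickP => [[u v] /= /and3P[/h/negPf -> //]|//].
Qed.

Section Adjacent.
Hypothesis e_irr : irreflexive e.
Variables (A B : worm_state) (u v : V).
Hypotheses (e_uv : e u v) (AB : val B = flip (val A) u v).

Lemma worm_state_C2 (C : worm_state) : val C \notin C0 -> val C \in C2.
Proof. by have := valP C; rewrite in_setU => /orP[->|]. Qed.

Lemma card_boundary_C0 (C : {set {set V}}) : C \in C0 -> #|boundary C| = 0.
Proof. by rewrite in_set => /andP[_ /eqP ->]; rewrite cards0. Qed.

Lemma card_boundary_C2 (C : {set {set V}}) : C \in C2 -> #|boundary C| = 2.
Proof. by rewrite in_set => /andP[_ /eqP]. Qed.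

Lemma worm_P_flip :
  (val A \in C2 -> val B \in C2 -> u \in boundary (val A)) ->
  worm_P A B = worm_rate (val A) u v.
Proof.
move=> hu.
have unv : u != v by apply/eqP => uv; move: e_uv; rewrite uv e_irr.
have nAB : A != B.
  apply/eqP => /(congr1 val); rewrite AB => /setP /(_ [set u; v]).
  by rewrite in_setU !in_setD in_set1 eqxx; case: (_ \in _).
rewrite /worm_P (negPf nAB) /worm_offdiag.
case: pickP => [[u' v'] /= /and3P[e_u'v' /eqP B' h]|/(_ (u, v))]; last first.
  by rewrite /= e_uv AB eqxx -AB /=; case: (boolP (_ && _)) => //= /andP[A2 B2];
    rewrite hu.
have E : [set u; v] = [set u'; v'] by apply: (@flip_inj (val A)); rewrite -AB.
have := set21 u v; have := set22 u v; rewrite E !in_set2.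
case/orP => /eqP vE; case/orP => /eqP uE; rewrite -?vE -?uE //.
- by move: unv; rewrite vE uE eqxx.
- rewrite /worm_rate [flip _ v u]/flip.
  have -> : [set v; u] = [set u; v] by rewrite E -vE -uE.
  rewrite -/(flip (val A) u v) -AB (addrC (1 / (deg v)%:R)).
  case: ifP => // /negbT/worm_state_C2 A2.
  case: ifP => // /negbT/worm_state_C2 B2.
  move: h (hu A2 B2); rewrite A2 B2 /= -vE => vb ub.
  have := card_boundary_C2 B2; rewrite AB.
  have -> : boundary (flip (val A) u v) = boundary (val A) :\: [set u; v].
    apply/setP => w; rewrite boundary_flip in_setD in_set2.
    by case: eqP => [->|]; case: eqP => [->|]; rewrite ?ub ?vb ?addbF ?addbT.
  have sub : [set u; v] \subset boundary (val A).
    by apply/fintype.subsetP => w; rewrite in_set2 => /orP[] /eqP ->.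
  by rewrite cardsDS // (card_boundary_C2 A2) cards2 unv.
- by move: unv; rewrite vE uE eqxx.
Qed.

Lemma worm_P_from_C0 : val A \in C0 ->
  worm_P A B = x ^+ ([set u; v] \notin val A) * (1 / (2 * #|V|%:R))
    * (1 / (deg u)%:R + 1 / (deg v)%:R).
Proof.
move=> A0; rewrite worm_P_flip /worm_rate ?A0 // => /card_boundary_C2.
by rewrite (card_boundary_C0 A0).
Qed.

Lemma worm_P_to_C0 : val B \in C0 ->
  worm_P A B = x ^+ ([set u; v] \notin val A) * (1 / 4)
    * (1 / (deg u)%:R + 1 / (deg v)%:R).
Proof.
move=> B0; rewrite worm_P_flip /worm_rate -?AB ?B0 /=; last first.
  by move=> _ /card_boundary_C2; rewrite (card_boundary_C0 B0).
case: ifP => // A0.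
have := boundary_flip (val A) u v u; rewrite -AB set21.
have C0_boundary C : C \in C0 -> boundary C = set0.
  by rewrite in_set => /andP[_ /eqP].
by rewrite !C0_boundary // !in_set0.
Qed.

Lemma worm_P_C2 :
  val A \in C2 -> val B \in C2 -> u \in boundary (val A) ->
  worm_P A B = Num.min ((deg u)%:R / (deg v)%:R
      * x ^ (([set u; v] \notin val A)%:Z - ([set u; v] \in val A)%:Z)) 1
    * (1 / (4 * (deg u)%:R)).
Proof.
move=> A2 B2 ub; rewrite worm_P_flip /worm_rate -?AB //.
case: ifP => [/card_boundary_C0|_]; first by rewrite (card_boundary_C2 A2).
by case: ifP => [/card_boundary_C0|//]; rewrite (card_boundary_C2 B2).
Qed.
End Adjacent.

End Weights.
End Worm.

(* Main.v *)
Require Import Defs.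
From HB Require Import structures.
From mathcomp Require Import all_boot all_order all_algebra.
From mathcomp Require Import ring lra zify complex.
From mathcomp Require Import all_classical all_reals all_analysis.

Import Order.TTheory GRing.Theory Num.Theory.
Local Open Scope ring_scope.

(** Why the theorem holds.  Write [A + B] for the symmetric difference of two
    edge sets, [n], [m], [Delta] for the numbers of vertices and edges and the
    maximum degree, and [Z] for the normalizing constant of the stationary
    measure.

    Canonical paths.  Let [I] be a worm configuration, [F] an Eulerian one and
    [D = I + F]; then [D] has zero or two odd vertices.  The edges of such a [D]
    can be removed one at a time so that every remainder has zero or two odd
    vertices: take any edge if no vertex is odd, and otherwise an edge at an odd
    vertex ([exists_dismantling]).  Adding [F] to the successive remainders
    gives a path of at most [m] worm moves from [I] to [F].

    Congestion.  For a move that flips the edge [g] in the configuration [A],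
    a pair [(I, F)] whose path uses this move is determined by [D]: if [X] is
    the remainder of [D] just before [g] is removed, then [F = A + X] and
    [I = F + D].  Moreover [|I| + |F| = |M| + |D + M|] with [M] the union of
    [A] and [{g}].  The factor [x ^ |M|] is paid for by the stationary flow
    through the move, which is at least [x ^ |M| / (2 Delta Z)]
    ([ps_flow_ge]); the other factor, summed over [D] with the weight [psi],
    is at most [n ^ 2] times the generating function of the Eulerian edge sets
    ([sum_psi_shift_le]).  The latter bound rests on the fact that, among the
    generating functions of edge sets with a prescribed set of odd vertices, the
    Eulerian one is the largest; in other words, the spin correlations of the
    Ising model are at most 1.  These functions are indeed the Fourier
    coefficients of the nonnegative function [\prod_f (1 + x * chi_f)] on the
    spin configurations ([boundary_sum_le]).
    Together this gives the Poincare inequality [worm_poincare] with constant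
    [C = 4 * Delta * m * n ^ 2].

    From the Poincare inequality to the three bounds.  The transition operator
    of a lazy reversible chain is positive semidefinite, so a Poincare
    inequality with constant [C] makes it a contraction of ratio [1 - 1 / C] on
    the functions of mean zero ([markov_contract]).  This bounds every
    nontrivial eigenvalue, and it makes the density of the chain at time [t]
    converge to 1 in mean square at the rate [(1 - 1 / C) ^ t].  The announced
    bounds have [n ^ 2 * C] in place of [C]; as [n >= 2], this leaves room for
    rounding the time to an integer and for rough lower bounds on the
    stationary masses. *)

(** * Lazy reversible finite chains *)

Section Chain.
Set Implicit Arguments.
Unset Strict Implicit.
Variables (R : realType) (T : finType) (P : T -> T -> R) (pi : T -> R).
Implicit Types f g : T -> R.

Record lazy_reversible : Prop := LazyReversible {
  chain_pi_gt0 : forall s, 0 < pi s;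
  chain_pi_sum : \sum_s pi s = 1;
  chain_ge0 : forall s s', 0 <= P s s';
  chain_sum : forall s, \sum_s' P s s' = 1;
  chain_rev : forall s s', pi s * P s s' = pi s' * P s' s;
  chain_lazy : forall s, 1 / 2 <= P s s }.

Definition avg f := \sum_s pi s * f s.
Definition markov_op f s := \sum_s' P s s' * f s'.
Definition dirichlet f :=
  1 / 2 * \sum_s \sum_s' pi s * P s s' * (f s - f s') ^+ 2.

Hypothesis ch : lazy_reversible.

Lemma eq_avg f g : f =1 g -> avg f = avg g.
Proof. by move=> fg; apply: eq_bigr => s _; rewrite fg. Qed.

Lemma avgD f g : avg (fun s => f s + g s) = avg f + avg g.
Proof. by rewrite -big_split; apply: eq_bigr => s _; rewrite mulrDr. Qed.

Lemma avgZ a f : avg (fun s => a * f s) = a * avg f.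
Proof. by rewrite mulr_sumr; apply: eq_bigr => s _; rewrite mulrCA. Qed.

Lemma avg_cst a : avg (fun=> a) = a.
Proof. by rewrite /avg -mulr_suml (chain_pi_sum ch) mul1r. Qed.

Lemma avg_sqr_ge0 f : 0 <= avg (fun s => f s ^+ 2).
Proof.
by apply: sumr_ge0 => s _; rewrite mulr_ge0 ?sqr_ge0 // ltW // chain_pi_gt0.
Qed.

Lemma avg_sqr_eq0 f : avg (fun s => f s ^+ 2) <= 0 -> forall s, f s = 0.
Proof.
move=> f0 s; apply/eqP; rewrite -sqrf_eq0.
have p0 t : 0 < pi t by exact: chain_pi_gt0.
have h t : true -> 0 <= pi t * f t ^+ 2.
  by move=> _; rewrite mulr_ge0 ?sqr_ge0 // ltW.
have /psumr_eq0P : \sum_t pi t * f t ^+ 2 = 0.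
  by apply/eqP; rewrite eq_le f0 sumr_ge0.
move=> /(_ h s isT) /eqP.
by rewrite mulf_eq0 (gt_eqF (p0 s)).
Qed.

Lemma markov_selfadj f g :
  avg (fun s => f s * markov_op g s) = avg (fun s => markov_op f s * g s).
Proof.
have lhs : avg (fun s => f s * markov_op g s)
    = \sum_s \sum_s' pi s * P s s' * (f s * g s').
  apply: eq_bigr => s _; rewrite !mulr_sumr; apply: eq_bigr => s' _; ring.
rewrite lhs exchange_big /=; apply: eq_bigr => s _.
rewrite mulr_suml mulr_sumr; apply: eq_bigr => s' _.
by rewrite (chain_rev ch); ring.
Qed.

Lemma markov_op1 s : markov_op (fun=> 1) s = 1.
Proof.
by rewrite -[RHS](chain_sum ch s); apply: eq_bigr => s' _; rewrite mulr1.
Qed.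

Lemma avg_markov f : avg (markov_op f) = avg f.
Proof.
have := markov_selfadj (fun=> 1) f.
rewrite (@eq_avg (fun s => 1 * _) (markov_op f)); last by move=> s; rewrite mul1r.
by move=> ->; apply: eq_avg => s; rewrite markov_op1 mul1r.
Qed.

(** The case [c = -1] expresses the Dirichlet form, the case [c = 1] shows that
    laziness makes the transition operator positive semidefinite. *)
Lemma double_sum_sqr (c : R) f : c ^+ 2 = 1 ->
  \sum_s \sum_s' pi s * P s s' * (f s + c * f s') ^+ 2
  = 2 * avg (fun s => f s ^+ 2) + 2 * c * avg (fun s => f s * markov_op f s).
Proof.
move=> c1.
have E1 : avg (fun s => f s ^+ 2) = \sum_s \sum_s' pi s * P s s' * f s ^+ 2.
  apply: eq_bigr => s _.
  rewrite -{1}[pi s]mulr1 -(chain_sum ch s) mulr_sumr mulr_suml.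
  by apply: eq_bigr.
have E2 : avg (fun s => f s ^+ 2) = \sum_s \sum_s' pi s * P s s' * f s' ^+ 2.
  rewrite E1 exchange_big; apply: eq_bigr => s _; apply: eq_bigr => s' _.
  by rewrite (chain_rev ch).
have E3 : avg (fun s => f s * markov_op f s)
    = \sum_s \sum_s' pi s * P s s' * (f s * f s').
  apply: eq_bigr => s _; rewrite !mulr_sumr; apply: eq_bigr => s' _; ring.
rewrite mulr_natl mulr2n {1}E1 E2 E3 mulr_sumr -!big_split /=.
apply: eq_bigr => s _; rewrite mulr_sumr -!big_split /=; apply: eq_bigr => s' _.
by rewrite sqrrD exprMn c1; ring.
Qed.

Lemma dirichletE f :
  dirichlet f = avg (fun s => f s ^+ 2) - avg (fun s => f s * markov_op f s).
Proof.
have := @double_sum_sqr (-1) f (etrans (sqrrN _) (expr1n _ _)).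
rewrite /dirichlet (eq_bigr (fun s => \sum_s' pi s * P s s' * (f s - f s') ^+ 2)).
  by move=> ->; field.
by move=> s _; apply: eq_bigr => s' _; rewrite mulN1r.
Qed.

(** In the double sum of [(f s + f s') ^+ 2] the diagonal terms alone already
    contribute [4 * P s s * f s ^+ 2 >= 2 * f s ^+ 2]. *)
Lemma lazy_psd f : 0 <= avg (fun s => f s * markov_op f s).
Proof.
have := @double_sum_sqr 1 f (expr1n _ _).
have : 2 * avg (fun s => f s ^+ 2) <=
    \sum_s \sum_s' pi s * P s s' * (f s + 1 * f s') ^+ 2.
  rewrite /avg mulr_sumr; apply: ler_sum => s _.
  rewrite (bigD1 s) //= -[leLHS]addr0 lerD //.
    have := chain_lazy ch s; have := chain_pi_gt0 ch s; have := sqr_ge0 (f s).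
    rewrite (_ : _ * (_ + _) ^+ 2 = 4 * P s s * (pi s * f s ^+ 2)); last by ring.
    by move=> f0 p0 l; apply: ler_wpM2r; [rewrite mulr_ge0 // ltW|lra].
  apply: sumr_ge0 => s' _; rewrite mulr_ge0 ?sqr_ge0 // mulr_ge0 ?(chain_ge0 ch) //.
  by rewrite ltW // (chain_pi_gt0 ch).
lra.
Qed.

Variable C : R.
Hypothesis C_gt1 : 1 < C.
Hypothesis poincare : forall f,
  avg f = 0 -> avg (fun s => f s ^+ 2) <= C * dirichlet f.

Let gamma : R := 1 - C^-1.

Lemma gamma_gt0 : 0 < gamma.
Proof. by rewrite subr_gt0 invf_lt1 // (lt_trans ltr01). Qed.

Lemma markov_quad_le f : avg f = 0 ->
  avg (fun s => f s * markov_op f s) <= gamma * avg (fun s => f s ^+ 2).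
Proof.
move=> /poincare; rewrite dirichletE.
have C0 : 0 < C by rewrite (lt_trans ltr01).
rewrite -ler_pdivrMl // /gamma; lra.
Qed.

(** The Cauchy-Schwarz inequality for the semidefinite form
    [avg (f * markov_op g)], read off from the single vector
    [gamma * f - markov_op f]: its form is nonnegative, and the Poincare
    inequality bounds the two square terms, for [f] and for [markov_op f]. *)
Lemma markov_contract f : avg f = 0 ->
  avg (fun s => markov_op f s ^+ 2) <= gamma ^+ 2 * avg (fun s => f s ^+ 2).
Proof.
move=> f0; have g0 := gamma_gt0; set g := markov_op f.
have g_avg : avg g = 0 by rewrite avg_markov.
have hf := markov_quad_le f0; have hg := markov_quad_le g_avg.
have := lazy_psd (fun s => gamma * f s - g s).
have -> : avg (fun s => (gamma * f s - g s) *
      markov_op (fun s => gamma * f s - g s) s)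
  = gamma ^+ 2 * avg (fun s => f s * markov_op f s)
    - 2 * gamma * avg (fun s => g s ^+ 2) + avg (fun s => g s * markov_op g s).
  have lin s : markov_op (fun s => gamma * f s - g s) s
      = gamma * g s - markov_op g s.
    rewrite /markov_op /g mulr_sumr -sumrB; apply: eq_bigr => s' _; ring.
  have adj : avg (fun s => f s * markov_op g s) = avg (fun s => g s ^+ 2).
    by rewrite markov_selfadj; apply: eq_avg => s; rewrite expr2.
  rewrite -/g.
  rewrite (@eq_avg _ (fun s => gamma ^+ 2 * (f s * g s) + (- gamma * g s ^+ 2
     + (- gamma * (f s * markov_op g s) + g s * markov_op g s)))); last first.
    by move=> s; rewrite lin; ring.
  by rewrite !avgD !avgZ adj; ring.
move: hf hg; rewrite -/g.
set a := avg _; set b := avg _; set c := avg _; set d := avg _ => hf hg h.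
have : gamma * d <= gamma * (gamma ^+ 2 * b).
  have : gamma ^+ 2 * a <= gamma ^+ 2 * (gamma * b).
    by rewrite ler_wpM2l // exprn_ge0 // ltW.
  have := hg; have := h; rewrite -/d; lra.
by rewrite ler_pM2l.
Qed.

Lemma markov_iter_contract t f : avg f = 0 ->
  avg (fun s => iter t markov_op f s ^+ 2)
    <= (gamma ^+ t) ^+ 2 * avg (fun s => f s ^+ 2).
Proof.
move=> f0; have avg0 k : avg (iter k markov_op f) = 0.
  by elim: k => //= k IH; rewrite avg_markov.
elim: t => [|t IH] /=; first by rewrite expr0 expr1n mul1r.
apply: le_trans (markov_contract (avg0 t)) _.
rewrite (exprS gamma t) exprMn -[leRHS]mulrA; apply: ler_wpM2l => //.
exact: sqr_ge0.
Qed.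

(** [f - avg f] has mean zero and is fixed, yet it is contracted. *)
Lemma fixed_const f : (forall s, markov_op f s = f s) -> forall s, f s = avg f.
Proof.
move=> fix_f; pose g s := f s - avg f.
have g0 : avg g = 0.
  by rewrite (@eq_avg g (fun s => f s + - avg f)) // avgD avg_cst subrr.
have fix_g s : markov_op g s = g s.
  rewrite /markov_op /g (eq_bigr (fun s' => P s s' * f s' - P s s' * avg f)).
    by rewrite sumrB -mulr_suml (chain_sum ch) mul1r [X in X - _]fix_f.
  by move=> s' _; rewrite mulrBr.
have := markov_contract g0.
rewrite (@eq_avg (fun s => markov_op g s ^+ 2) (fun s => g s ^+ 2)); last first.
  by move=> s; rewrite fix_g.
set N := avg _ => hN s; apply/eqP; rewrite -subr_eq0; apply/eqP.
apply: (@avg_sqr_eq0 g); rewrite -/N.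
have g1 : gamma ^+ 2 < 1.
  rewrite expr_lt1 // ?ltW ?gamma_gt0 // /gamma gtrBl invr_gt0.
  by rewrite (lt_trans ltr01).
have : 0 <= (gamma ^+ 2 - 1) * N by rewrite mulrBl mul1r subr_ge0.
by rewrite nmulr_rge0 // subr_lt0.
Qed.

(** Dividing a left eigenvector by [pi] turns it, by reversibility, into an
    eigenfunction of [markov_op], whose real and imaginary parts [f] and [g] are
    rotated and scaled into each other by the eigenvalue.  If the eigenvalue is
    not 1 both have mean zero and the contraction applies to the sum of their
    squared norms; if it is 1 both are constant, so the eigenspace is the line
    of [pi] and the eigenvalue is trivial. *)
Lemma nontrivial_eigenvalue_le a :
  nontrivial_eigenvalue P a -> ComplexField.Normc.normc a <= gamma.
Proof.
case/andP; set M := map_mx _ _.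
case: a => al be.
(* the eigenvalue equation in real coordinates *)
have coord (v : 'rV_#|T|) (b c : R) : v *m M = (b +i* c)%C *: v ->
  let f s := complex.Re (v 0 (enum_rank s)) / pi s in
  let g s := complex.Im (v 0 (enum_rank s)) / pi s in
  (forall s, markov_op f s = b * f s - c * g s) /\
  (forall s, markov_op g s = c * f s + b * g s).
  move=> /matrixP /(_ 0) vM f g.
  have key s : \sum_s' v 0 (enum_rank s') * (P s' s)%:C%C
      = (b +i* c)%C * v 0 (enum_rank s).
    have := vM (enum_rank s); rewrite !mxE => <-.
    rewrite (reindex enum_rank) /=; last exact/onW_bij/enum_rank_bij.
    by apply: eq_bigr => s' _; rewrite !mxE !enum_rankK.
  have swap s s' : P s s' / pi s' = P s' s / pi s.
    have p0 t : pi t != 0 by rewrite gt_eqF // (chain_pi_gt0 ch).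
    by apply/eqP; rewrite eqr_div // mulrC (chain_rev ch) mulrC.
  split=> s.
  - have := congr1 (@complex.Re R) (key s); rewrite raddf_sum /=.
    case E : (v 0 (enum_rank s)) => [vr vi] /= H.
    rewrite /f /g E /= !mulrA -mulrBl -H mulr_suml; apply: eq_bigr => s' _.
    case: (v 0 (enum_rank s')) => [wr wi] /=.
    by rewrite mulr0 subr0 mulrCA swap mulrA.
  - have := congr1 (@complex.Im R) (key s); rewrite raddf_sum /=.
    case E : (v 0 (enum_rank s)) => [vr vi] /= H.
    rewrite /f /g E /= !mulrA -mulrDl addrC -H mulr_suml; apply: eq_bigr => s' _.
    case: (v 0 (enum_rank s')) => [wr wi] /=.
    by rewrite mulr0 add0r mulrCA swap mulrA.
move=> ev.
have [a1|a1] := eqVneq ((al +i* be)%C) 1.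
  move=> /=; suff -> : (\rank (eigenspace M 1) == 1)%N by [].
  rewrite eqn_leq lt0n mxrank_eq0; apply/andP; split; last by move: ev; rewrite a1.
  pose r : 'rV[R[i]]_#|T| := \row_j ((pi (enum_val j))%:C)%C.
  apply: leq_trans (rank_leq_row r); apply: mxrankS.
  have WP : eigenspace M 1 *m M = 1 *: eigenspace M 1 by apply/eigenspaceP.
  move: (eigenspace M 1) WP => W WP.
  apply/row_subP => k.
  have : row k W *m M = ((1 : R) +i* 0)%C *: row k W.
    by rewrite -row_mul WP !scale1r.
  move=> /coord /= [hf hg].
  have := fixed_const (f := fun s => complex.Re (row k W 0 (enum_rank s)) / pi s).
  have := fixed_const (f := fun s => complex.Im (row k W 0 (enum_rank s)) / pi s).
  set cI := avg _; set cR := avg _ => cI_eq cR_eq.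
  apply/submxP; exists ((cR +i* cI)%C)%:M; rewrite mul_scalar_mx.
  apply/rowP => j; rewrite [in RHS]mxE [r _ _]mxE.
  have p0 : pi (enum_val j) != 0 by rewrite gt_eqF // (chain_pi_gt0 ch).
  have hR : complex.Re (row k W 0 j) = cR * pi (enum_val j).
    rewrite -[cR](cR_eq _ (enum_val j)) ?enum_valK ?divfK // => s.
    by rewrite hf; ring.
  have hI : complex.Im (row k W 0 j) = cI * pi (enum_val j).
    rewrite -[cI](cI_eq _ (enum_val j)) ?enum_valK ?divfK // => s.
    by rewrite hg; ring.
  move: hR hI; case: (row k W 0 j) => [vr vi] /= -> ->.
  by rewrite /GRing.mul /= !mulr0 subr0 add0r.
move=> _.
case/eigenvalueP: ev => v /coord [].
set f := fun s => complex.Re _ / _; set g := fun s => complex.Im _ / _.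
move=> hf hg v0.
have Af : avg f = al * avg f - be * avg g.
  rewrite -{1}avg_markov (eq_avg hf) (@eq_avg _ (fun s => al * f s + (- be) * g s)).
    by rewrite avgD !avgZ mulNr.
  by move=> s; rewrite mulNr.
have Ag : avg g = be * avg f + al * avg g.
  by rewrite -{1}avg_markov (eq_avg hg) avgD !avgZ.
have ne : (al - 1) ^+ 2 + be ^+ 2 != 0.
  apply: contra a1; rewrite paddr_eq0 ?sqr_ge0 // !sqrf_eq0 subr_eq0.
  by case/andP => /eqP -> /eqP ->.
have e1 : (al - 1) * avg f - be * avg g = 0 by lra.
have e2 : be * avg f + (al - 1) * avg g = 0 by lra.
have f0 : avg f = 0.
  apply: (mulfI ne); rewrite mulr0.
  transitivity ((al - 1) * ((al - 1) * avg f - be * avg g)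
                + be * (be * avg f + (al - 1) * avg g)); first ring.
  by rewrite e1 e2 !mulr0 addr0.
have g0 : avg g = 0.
  apply: (mulfI ne); rewrite mulr0.
  transitivity ((al - 1) * (be * avg f + (al - 1) * avg g)
                - be * ((al - 1) * avg f - be * avg g)); first ring.
  by rewrite e1 e2 !mulr0 subr0.
have := lerD (markov_contract f0) (markov_contract g0).
rewrite (@eq_avg _ (fun s => al ^+ 2 * f s ^+ 2 + (be ^+ 2 * g s ^+ 2
   + (- (2 * al * be)) * (f s * g s)))); last by move=> s; rewrite hf /f /g; ring.
rewrite (@eq_avg (fun s => markov_op g s ^+ 2) (fun s => be ^+ 2 * f s ^+ 2
   + (al ^+ 2 * g s ^+ 2 + 2 * al * be * (f s * g s)))); last first.
  by move=> s; rewrite hg /f /g; ring.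
rewrite !avgD !avgZ -mulrDr.
set F := avg _; set G := avg _ => H.
have FG : 0 < F + G.
  rewrite lt_neqAle addr_ge0 ?avg_sqr_ge0 // andbT eq_sym.
  apply: contra v0; rewrite paddr_eq0 ?avg_sqr_ge0 // => /andP[/eqP F0 /eqP G0].
  apply/eqP/rowP => j; rewrite mxE -[j]enum_valK; set s := enum_val j.
  have := @avg_sqr_eq0 f _ s; have := @avg_sqr_eq0 g _ s.
  rewrite -/F -/G F0 G0 lexx => /(_ isT) gs /(_ isT) fs.
  have p0 : pi s != 0 by rewrite gt_eqF // (chain_pi_gt0 ch).
  move: fs gs; rewrite /f /g; case: (v 0 _) => [vr vi] /= fs gs.
  move/eqP: fs; rewrite mulf_eq0 invr_eq0 (negPf p0) orbF => /eqP ->.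
  by move/eqP: gs; rewrite mulf_eq0 invr_eq0 (negPf p0) orbF => /eqP ->.
have : al ^+ 2 + be ^+ 2 <= gamma ^+ 2.
  rewrite -(ler_pM2r FG); lra.
move=> H2; rewrite /= -(ger0_norm (ltW gamma_gt0)) -sqrtr_sqr ler_wsqrtr //.
Qed.

Lemma lambda_star_le : lambda_star P <= gamma.
Proof.
rewrite /lambda_star; set E := (X in sup X).
have [->|/set0P E0] := eqVneq E classical_sets.set0.
  by rewrite sup0 ltW // gamma_gt0.
by apply: ge_sup => // _ [a /= a_ev <-]; apply: nontrivial_eigenvalue_le.
Qed.

Lemma trel_le : (trel P <= C%:E)%E.
Proof.
have C0 : 0 < C by rewrite (lt_trans ltr01).
have gap : C^-1 <= 1 - lambda_star P by have := lambda_star_le; rewrite /gamma; lra.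
have gap0 : 0 < 1 - lambda_star P by rewrite (lt_le_trans _ gap) // invr_gt0.
rewrite /trel inver gt_eqF // lee_fin -[leRHS]invrK.
by rewrite lef_pV2 // posrE invr_gt0.
Qed.

Lemma chain_iterSr t s s' :
  chain_iter P t.+1 s s' = \sum_u chain_iter P t s u * P u s'.
Proof.
rewrite /chain_iter exprSr mxE (reindex enum_rank) /=; last first.
  exact/onW_bij/enum_rank_bij.
by apply: eq_bigr => u _; rewrite !mxE !enum_rankK.
Qed.

(** The density with respect to [pi] of the signed measure
    (point mass at [s]) - [pi]. *)
Let start_density s s' := (s' == s)%:R / pi s' - 1.

(** By reversibility the density at time [t], with 1 subtracted, evolves under
    [markov_op] itself. *)
Lemma chain_iter_density t s s' :
  chain_iter P t s s' / pi s' - 1 = iter t markov_op (start_density s) s'.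
Proof.
elim: t s' => [|t IH] s'.
  by rewrite /chain_iter expr0 mxE (inj_eq enum_rank_inj) eq_sym.
transitivity (markov_op (fun u => chain_iter P t s u / pi u - 1) s'); last first.
  by apply: eq_bigr => u _; rewrite IH.
rewrite chain_iterSr /markov_op; under [RHS]eq_bigr do rewrite mulrBr mulr1.
rewrite sumrB (chain_sum ch) mulr_suml; congr (_ - _).
apply: eq_bigr => u _.
have p0 v : pi v != 0 by rewrite gt_eqF // (chain_pi_gt0 ch).
apply: (mulfI (p0 u)); apply: (mulfI (p0 s')).
transitivity (pi u * P u s' * chain_iter P t s u); first by field; exact: p0.
by rewrite (chain_rev ch); field; exact: p0.
Qed.

Lemma avg_start_density s : avg (start_density s) = 0.
Proof.
rewrite /avg (eq_bigr (fun s' => (s' == s)%:R - pi s')).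
  rewrite sumrB (chain_pi_sum ch) (bigD1 s) //= eqxx big1 ?addr0 ?subrr //.
  by move=> s' /negPf ->.
move=> s' _; have p0 : pi s' != 0 by rewrite gt_eqF // (chain_pi_gt0 ch).
by rewrite /start_density; field.
Qed.

(** The exact value is [(pi s)^-1 - 1]; the square loses only a factor which the
    final bounds can afford, and avoids square roots. *)
Lemma avg_start_density_sqr_le s :
  avg (fun s' => start_density s s' ^+ 2) <= (pi s)^-1 ^+ 2.
Proof.
have p0 v : 0 < pi v by exact: (chain_pi_gt0 ch).
have p1 : pi s <= 1.
  rewrite -(chain_pi_sum ch) (bigD1 s) //= lerDl sumr_ge0 // => v _.
  exact/ltW.
have -> : avg (fun s' => start_density s s' ^+ 2) = (pi s)^-1 - 1.
  rewrite /avg.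
  rewrite (eq_bigr (fun s' => ((s' == s)%:R * (pi s)^-1 - pi s') - 2 * (pi s' * start_density s s'))).
    rewrite sumrB -mulr_sumr -/(avg (start_density s)) avg_start_density mulr0 subr0.
    rewrite sumrB (chain_pi_sum ch) (bigD1 s) //= eqxx big1 ?addr0 ?mul1r //.
    by move=> s' /negPf ->; rewrite mul0r.
  move=> s' _; rewrite /start_density.
  have /negbT ps := gt_eqF (p0 s); have /negbT ps' := gt_eqF (p0 s').
  by have [->|_] := eqVneq s' s; rewrite ?mulr1n ?mulr0n; field; rewrite ?ps ?ps'.
have : 1 <= (pi s)^-1 by rewrite invf_ge1.
set q := _^-1 => q1; rewrite expr2.
have : 0 <= (q - 1) * q by rewrite mulr_ge0 // ?subr_ge0 // (le_trans ler01).
lra.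
Qed.

(** The discrepancy on an event is at most the mean absolute value of the
    centred density, hence at most its root mean square. *)
Lemma tv_dist_le t s : tv_dist (chain_iter P t s) pi <= gamma ^+ t / pi s.
Proof.
have p0 v : 0 < pi v by exact: (chain_pi_gt0 ch).
have g0 : 0 <= gamma ^+ t by rewrite exprn_ge0 // ltW // gamma_gt0.
have B0 : 0 <= gamma ^+ t / pi s by rewrite divr_ge0 // ltW.
apply: bigmax_le => // S _.
pose h := iter t markov_op (start_density s).
have E : \sum_(s' in S) chain_iter P t s s' - \sum_(s' in S) pi s'
    = \sum_(s' in S) pi s' * h s'.
  rewrite -sumrB; apply: eq_bigr => s' _.
  rewrite /h -chain_iter_density; have /negbT p := gt_eqF (p0 s').
  by field.
have le1 : `|\sum_(s' in S) pi s' * h s'| <= avg (fun s' => `|h s'|).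
  apply: le_trans (ler_norm_sum _ _ _) _.
  rewrite /avg [leRHS](bigID (fun s' => s' \in S)) /= -[leLHS]addr0 lerD //.
    by apply: ler_sum => s' _; rewrite normrM (gtr0_norm (p0 s')).
  by apply: sumr_ge0 => s' _; rewrite mulr_ge0 // ltW.
have jensen : avg (fun s' => `|h s'|) ^+ 2 <= avg (fun s' => h s' ^+ 2).
  set c := avg _.
  have := avg_sqr_ge0 (fun s' => `|h s'| - c).
  rewrite (@eq_avg _ (fun s' => h s' ^+ 2 + ((- (2 * c)) * `|h s'| + c ^+ 2))).
    by rewrite !avgD avgZ avg_cst -/c; lra.
  by move=> s'; rewrite sqrrB real_normK ?num_real //; ring.
have le2 := le_trans jensen (markov_iter_contract t (avg_start_density s)).
rewrite E; apply: le_trans le1 _.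
rewrite -(@ler_pXn2r _ 2) // ?nnegrE //; last first.
  by apply: sumr_ge0 => s' _; rewrite mulr_ge0 // ltW.
apply: le_trans le2 _; rewrite exprMn ler_wpM2l ?sqr_ge0 //.
exact: avg_start_density_sqr_le.
Qed.

(** At time [t = floor b] the distance is at most [expR (- t / C) / pi s]; the 1
    on the left makes up for the rounding, since [b < t + 1]. *)
Lemma tmix_from_le s (d b : R) : 0 < d -> 0 <= b ->
  1 - C * ln (pi s * d) <= b -> (tmix_from P pi s d <= b%:E)%E.
Proof.
move=> d0 b0 hb; have ps0 := chain_pi_gt0 ch s.
have C0 : 0 < C by rewrite (lt_trans ltr01).
set t := Num.truncn b.
have /andP[tb bt] := truncn_itv b0.
apply: (@le_trans _ _ (t%:R)%:E); last by rewrite lee_fin.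
apply: ereal_inf_lbound; exists t => //=.
apply: le_trans (tv_dist_le t s) _.
rewrite ler_pdivrMr // mulrC.
have gE : gamma <= expR (- C^-1) by rewrite /gamma; exact: expR_ge1Dx.
apply: (@le_trans _ _ (expR (- C^-1) ^+ t)).
  by rewrite lerXn2r // nnegrE ?expR_ge0 // ltW // gamma_gt0.
rewrite -expRM_natl -[leRHS]lnK ?posrE ?mulr_gt0 // ler_expR.
rewrite mulrN -[leRHS]opprK lerN2 ler_pdivlMr // mulNr.
move: bt; rewrite -/t -natr1; lra.
Qed.
End Chain.

(** * Symmetric differences and odd vertices *)

Section SymmetricDifference.
Set Implicit Arguments.
Unset Strict Implicit.
Import mathcomp.boot.finset.
Local Open Scope set_scope.
Variable T : finType.
Implicit Types A B C : {set T}.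

Definition symd A B := (A :\: B) :|: (B :\: A).

Lemma in_symd A B z : (z \in symd A B) = (z \in A) (+) (z \in B).
Proof. by rewrite in_setU !in_setD; case: (z \in A); case: (z \in B). Qed.

Lemma symdC A B : symd A B = symd B A.
Proof. by apply/setP => z; rewrite !in_symd addbC. Qed.

Lemma symdA A B C : symd A (symd B C) = symd (symd A B) C.
Proof. by apply/setP => z; rewrite !in_symd addbA. Qed.

Lemma symd0 A : symd A set0 = A.
Proof. by apply/setP => z; rewrite in_symd in_set0 addbF. Qed.

Lemma symdd A : symd A A = set0.
Proof. by apply/setP => z; rewrite in_symd in_set0 addbb. Qed.

Lemma symdK B : involutive (symd^~ B).
Proof. by move=> A; rewrite -symdA symdd symd0. Qed.

Lemma symdKl A : involutive (symd A).
Proof. by move=> B; rewrite symdA symdd symdC symd0. Qed.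

Lemma card_symd A B : (#|symd A B| + #|A :&: B|.*2)%N = (#|A| + #|B|)%N.
Proof.
rewrite /symd cardsU (_ : _ :&: _ = set0); last first.
  by apply/setP => z; rewrite !inE; case: (z \in A); case: (z \in B).
rewrite cards0 subn0 -(cardsID B A) -(cardsID A B) [B :&: A]setIC -addnn.
by rewrite [RHS]addnACA [RHS]addnC.
Qed.

Lemma odd_card_symd A B : odd #|symd A B| = odd #|A| (+) odd #|B|.
Proof. by rewrite -oddD -card_symd oddD odd_double addbF. Qed.

Lemma symd_set1D A z : z \in A -> symd A [set z] = A :\ z.
Proof.
move=> zA; apply/setP => y; rewrite in_symd in_setD1 in_set1.
by case: eqP => [->|_]; rewrite ?zA ?addbF.
Qed.

Lemma symd_set1U A z : z \notin A -> symd A [set z] = z |: A.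
Proof.
move=> zA; apply/setP => y; rewrite in_symd in_setU1 in_set1.
by case: eqP => [->|_]; rewrite ?(negPf zA) ?addbF.
Qed.

Lemma symd_subset A B C : B \subset C -> (symd A B \subset C) = (A \subset C).
Proof.
move=> /fintype.subsetP BC.
have sub A' : A' \subset C -> symd A' B \subset C.
  move=> /fintype.subsetP AC; apply/fintype.subsetP => z; rewrite in_symd.
  by have := AC z; have := BC z; do 3!case: (z \in _) => //=; move=> h1 h2; rewrite ?h1 ?h2.
by apply/idP/idP => [/sub|/sub//]; rewrite symdK.
Qed.

(** Both sides are the size of [A] plus twice the size of [B :\: A]. *)
Lemma card_symd_swap A B C : B :\: A = C :\: A ->
  (#|symd A B| + #|B| = #|symd A C| + #|C|)%N.
Proof.
move=> BC; have := card_symd A B; have := card_symd A C.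
have := cardsID A B; have := cardsID A C; rewrite BC [B :&: A]setIC [C :&: A]setIC.
by rewrite -!addnn; lia.
Qed.
End SymmetricDifference.

Section Boundary.
Set Implicit Arguments.
Unset Strict Implicit.
Import mathcomp.boot.finset.
Local Open Scope set_scope.
Variable V : finType.
Implicit Types A B : {set {set V}}.

Lemma in_boundary A v : (v \in boundary A) = odd #|[set f in A | v \in f]|.
Proof. by rewrite inE. Qed.

Lemma boundary_symd A B : boundary (symd A B) = symd (boundary A) (boundary B).
Proof.
apply/setP => v; rewrite in_symd !in_boundary -odd_card_symd; congr (odd #|pred_of_set _|).
by apply/setP => f; rewrite !(in_symd, inE); case: (v \in f); rewrite ?andbT ?andbF.
Qed.

Lemma boundary1 (f : {set V}) : boundary [set f] = f.
Proof.
apply/setP => v; rewrite in_boundary.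
have [vf|vf] := boolP (v \in f).
  rewrite (_ : [set _ in _ | _] = [set f]) ?cards1 //.
  by apply/setP => g; rewrite !inE; case: eqP => // ->.
rewrite (_ : [set _ in _ | _] = set0) ?cards0 //.
by apply/setP => g; rewrite !inE; case: eqP => // ->; rewrite (negPf vf).
Qed.

Lemma boundary0 : boundary set0 = set0 :> {set V}.
Proof. by rewrite -(symdd set0) boundary_symd symdd. Qed.
End Boundary.

(** * The high-temperature expansion *)

Section Characters.
Set Implicit Arguments.
Unset Strict Implicit.
Import mathcomp.boot.finset.
Local Open Scope set_scope.
Variables (R : realType) (V : finType).
Implicit Types (S sigma : {set V}) (A : {set {set V}}).

(** The subsets of [V] form a group under symmetric difference; [sigma] is the
    set of vertices with spin -1, and [character S sigma] is the product of the
    spins over [S]. *)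
Definition character S sigma : R := (-1) ^+ #|S :&: sigma|.

Lemma characterD S S' sigma :
  character (symd S S') sigma = character S sigma * character S' sigma.
Proof.
rewrite /character -exprD -signr_odd -[in RHS]signr_odd oddD -odd_card_symd.
congr (_ ^+ odd #|pred_of_set _|).
by apply/setP => v; rewrite !(in_symd, inE); case: (v \in sigma); rewrite ?andbT ?andbF.
Qed.

Lemma characterC S sigma : character S sigma = character sigma S.
Proof. by rewrite /character setIC. Qed.

Lemma normr_character S sigma : `|character S sigma| = 1.
Proof. exact: normr_sign. Qed.

(** If [v] is in [S], flipping the spin at [v] changes the sign of every term. *)
Lemma sum_character S :
  \sum_(sigma : {set V}) character S sigma = (S == set0)%:R * 2 ^+ #|V|.
Proof.
have [->|/set0Pn[v vS]] := eqVneq S set0.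
  transitivity (\sum_(sigma in powerset [set: V]) (1 : R)).
    apply: eq_big => [sigma|sigma _]; first by rewrite !inE subsetT.
    by rewrite /character set0I cards0.
  by rewrite sumr_const card_powerset cardsT mul1r natrX.
rewrite mul0r; set s := \sum_sigma _.
have : s = - s.
  rewrite {1}/s (reindex_inj (inv_inj (@symdK _ [set v]))) /= -sumrN.
  apply: eq_bigr => sigma _; rewrite characterC characterD characterC mulrC.
  rewrite {1}/character (_ : [set v] :&: S = [set v]) ?cards1 ?mulN1r //.
  by apply/setIidPl; rewrite sub1set.
lra.
Qed.

(** A spin occurs in the product over the edges as often as [A] has edges at
    this vertex, so only the odd vertices count. *)
Lemma character_boundary A sigma :
  character (boundary A) sigma = \prod_(f in A) character f sigma.
Proof.
move: {2}#|A| (leqnn #|A|) => k; elim: k A => [|k IH] A.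
  rewrite leqn0 cards_eq0 => /eqP ->.
  by rewrite boundary0 big_set0 /character set0I cards0.
have [-> _|/set0Pn[f fA] Ak] := eqVneq A set0.
  by rewrite boundary0 big_set0 /character set0I cards0.
rewrite (big_setD1 f) //= -IH.
  by rewrite -(symd_set1D fA) boundary_symd characterD boundary1 mulrCA -characterD symdd
     /character set0I cards0 mulr1.
by move: Ak; rewrite (cardsD1 f) fA.
Qed.
End Characters.

Section Correlation.
Set Implicit Arguments.
Unset Strict Implicit.
Import mathcomp.boot.finset.
Local Open Scope set_scope.
Variables (R : realType) (V : finType) (E : {set {set V}}) (x : R).
Hypothesis x01 : 0 <= x <= 1.
Implicit Types (S sigma : {set V}) (A D M : {set {set V}}).

(** The numerator of the correlation of the spins in [S] in the
    high-temperature expansion; the denominator is [boundary_sum set0]. *)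
Definition boundary_sum S : R :=
  \sum_(A : {set {set V}} | (A \subset E) && (boundary A == S)) x ^+ #|A|.

(** Expanding [\prod_(f in E) (1 + x * character f sigma)] gives this sum, and
    all factors are nonnegative. *)
Lemma transform_ge0 sigma :
  0 <= \sum_(A : {set {set V}} | A \subset E) x ^+ #|A| * character R (boundary A) sigma.
Proof.
have -> : \sum_(A : {set {set V}} | A \subset E) x ^+ #|A| * character R (boundary A) sigma
    = \prod_(f in E) (1 + x * character R f sigma).
  rewrite [RHS]big_mkcond /=.
  rewrite [RHS](eq_bigr (fun f => (if f \in E then x * character R f sigma else 0) + 1)).
    rewrite bigA_distr big_mkcond /=; apply: eq_bigr => A _.
    case: (boolP (A \subset E)) => [AE|/fintype.subsetPn[f fA fE]].
      rewrite -big_mkcond /= (eq_bigr (fun f => x * character R f sigma)).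
        by rewrite big_split /= -character_boundary prodr_const.
      by move=> f fA; rewrite (fintype.subsetP AE).
    by rewrite (bigD1 f) //= fA (negPf fE) mul0r.
  by move=> f _; case: ifP => _; rewrite ?add0r // addrC.
apply: prodr_ge0 => f _.
have := normr_character R f sigma; move/andP: x01 => [x0 x1].
have : - `|character R f sigma| <= character R f sigma by rewrite lerNl -normrN ler_norm.
rewrite normr_character => h _.
by have : x * (-1) <= x * character R f sigma; [rewrite ler_wpM2l | lra].
Qed.

(** Orthogonality of the characters. *)
Lemma boundary_sum_fourier S : 2 ^+ #|V| * boundary_sum S =
  \sum_sigma character R S sigma *
    \sum_(A : {set {set V}} | A \subset E) x ^+ #|A| * character R (boundary A) sigma.
Proof.
under [RHS]eq_bigr do rewrite mulr_sumr.
rewrite exchange_big /= /boundary_sum mulr_sumr.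
rewrite [RHS](bigID (fun A => boundary A == S)) /= [X in _ = _ + X]big1 ?addr0.
  apply: eq_bigr => A /andP[_ /eqP <-].
  under eq_bigr do rewrite mulrCA -characterD symdd.
  by rewrite -mulr_sumr sum_character eqxx mul1r mulrC.
move=> A /andP[_ AS].
under eq_bigr do rewrite mulrCA -characterD.
rewrite -mulr_sumr sum_character [_ == set0](_ : _ = false) ?mul0r ?mulr0 //.
apply: contraNF AS => /eqP SA; apply/eqP.
by rewrite -[RHS](symdK (boundary A)) SA symdC symd0.
Qed.

Lemma boundary_sum_le S : boundary_sum S <= boundary_sum set0.
Proof.
rewrite -(@ler_pM2l _ (2 ^+ #|V|)) ?exprn_gt0 // !boundary_sum_fourier.
apply: ler_sum => sigma _; rewrite ler_wpM2r ?transform_ge0 //.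
have -> : character R set0 sigma = 1 by rewrite /character set0I cards0.
by rewrite (le_trans (ler_norm _)) // normr_character.
Qed.

(** [D + M] runs over the subsets of [E] with boundary [S + boundary M]. *)
Lemma boundary_sum_shift S M : M \subset E ->
  \sum_(D : {set {set V}} | (D \subset E) && (boundary D == S)) x ^+ #|symd D M|
  = boundary_sum (symd S (boundary M)).
Proof.
move=> ME; rewrite /boundary_sum [RHS](reindex_inj (inv_inj (@symdK _ M))) /=.
apply: eq_bigl => D; rewrite boundary_symd (inj_eq (inv_inj (@symdK _ (boundary M)))).
by rewrite symd_subset.
Qed.
End Correlation.

(** * Canonical paths and their congestion *)

Section Worm.
Set Implicit Arguments.
Unset Strict Implicit.
Import mathcomp.boot.finset.
Local Open Scope set_scope.
Variables (R : realType) (V : finType) (e : rel V).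
Hypothesis e_irr : irreflexive e.
Implicit Types (A B D F I : {set {set V}}) (f g : {set V}) (u v : V).

Local Notation E := (edges e).
Local Notation W := (worm_config e).

Lemma edgeP g : reflect (exists u v, e u v /\ g = [set u; v]) (g \in E).
Proof.
apply: (iffP imsetP) => [[[u v] /= uv ->]|[u [v [uv ->]]]].
  by exists u, v; split=> //; move: uv; rewrite inE.
by exists (u, v) => //; rewrite inE.
Qed.

Lemma edge_neq u v : e u v -> u != v.
Proof. by apply: contraTneq => ->; rewrite e_irr. Qed.

Lemma card_edge g : g \in E -> #|g| = 2%N.
Proof. by case/edgeP => u [v [uv ->]]; rewrite cards2 edge_neq. Qed.

Lemma in_C0 A : (A \in C0 e) = (A \subset E) && (boundary A == set0).
Proof. by rewrite !inE. Qed.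

Lemma in_C2 A : (A \in C2 e) = (A \subset E) && (#|boundary A| == 2%N).
Proof. by rewrite !inE. Qed.

Lemma in_W A : (A \in W) = (A \subset E) && ((#|boundary A| == 0%N) || (#|boundary A| == 2%N)).
Proof. by rewrite in_setU in_C0 in_C2 -andb_orr cards_eq0. Qed.

Lemma W_sub A : A \in W -> A \subset E.
Proof. by rewrite in_W => /andP[]. Qed.

Lemma C0_W A : A \in C0 e -> A \in W.
Proof. by move=> A0; rewrite in_setU A0. Qed.

Lemma symd_C0 A F : F \in C0 e -> (symd A F \in C0 e) = (A \in C0 e).
Proof.
rewrite !in_C0 => /andP[FE /eqP F0].
by rewrite symd_subset // boundary_symd F0 symd0.
Qed.

Lemma symd_W A F : F \in C0 e -> (symd A F \in W) = (A \in W).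
Proof.
rewrite in_C0 !in_W => /andP[FE /eqP F0].
by rewrite symd_subset // boundary_symd F0 symd0.
Qed.

(** Removing an edge adds its two ends to the boundary.  If [boundary D] is
    empty, the result has two elements; if one of the ends is in [boundary D],
    at most two elements are left, and their number is even. *)
Lemma exists_removable D : D \in W -> D != set0 ->
  exists2 g, g \in D & D :\ g \in W.
Proof.
move=> DW D0; have DE := W_sub DW.
suff [g gD [v vg vD]] : exists2 g, g \in D &
    exists2 v, v \in g & (v \in boundary D) || (boundary D == set0).
  exists g => //; have gE := fintype.subsetP DE _ gD.
  have g1E : [set g] \subset E by rewrite sub1set.
  rewrite in_W -(symd_set1D gD) symd_subset // DE boundary_symd boundary1 /=.
  have := card_symd (boundary D) g; rewrite (card_edge gE).
  case/orP: vD => [vD|/eqP ->]; last first.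
    by rewrite cards0 set0I cards0 addn0 => ->; rewrite orbT.
  have : (0 < #|boundary D :&: g|)%N.
    by apply/card_gt0P; exists v; rewrite in_setI vD.
  have : (0 < #|boundary D|)%N by apply/card_gt0P; exists v.
  move: DW; rewrite in_W => /andP[_ /orP[] /eqP ->] // _.
  by rewrite -addnn => c0 c4; lia.
have [b0|/set0Pn[v vb]] := eqVneq (boundary D) set0.
  case/set0Pn: D0 => g gD; exists g => //.
  have := card_edge (fintype.subsetP DE _ gD) => g2.
  have /card_gt0P[v vg] : (0 < #|g|)%N by rewrite g2.
  by exists v => //; rewrite orbT.
have : (0 < #|[set f in D | v \in f]|)%N.
  by move: vb; rewrite in_boundary; case: #|_|.
case/card_gt0P => g; rewrite inE => /andP[gD vg].
by exists g => //; exists v => //; rewrite vb.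
Qed.

(** [rest g] is what is left of [D] just before [g] is removed.  The
    telescoping identity, for every [h], encodes that the removals follow one
    another from [D] down to the empty set. *)
Definition dismantles D (rest : {set V} -> {set {set V}}) : Prop :=
  (forall g, g \in D -> [/\ g \in rest g, rest g \subset D,
      rest g \in W & rest g :\ g \in W]) /\
  (forall h : {set {set V}} -> R,
      h D - h set0 = \sum_(g in D) (h (rest g) - h (rest g :\ g))).

Lemma exists_dismantling D : D \in W -> exists rest, dismantles D rest.
Proof.
move: {2}#|D| (leqnn #|D|) => k; elim: k D => [|k IH] D.
  rewrite leqn0 cards_eq0 => /eqP -> _; exists (fun=> set0).
  by split=> [g|h]; rewrite ?in_set0 // big_set0 subrr.
have [-> _ _|D0 Dk DW] := eqVneq D set0.
  exists (fun=> set0).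
  by split=> [g|h]; rewrite ?in_set0 // big_set0 subrr.
have [g0 g0D DgW] := exists_removable DW D0.
have [|rest [restP restE]] := IH (D :\ g0) _ DgW.
  by move: Dk; rewrite (cardsD1 g0) g0D.
exists (fun g => if g == g0 then D else rest g); split=> [g gD|h].
  have [->|ng] := eqVneq g g0; first by split.
  have [|gr rD rW rgW] := restP g; first by rewrite in_setD1 ng.
  split=> //; exact: fintype.subset_trans rD (subsetDl _ _).
rewrite (big_setD1 g0) //= eqxx.
rewrite (eq_bigr (fun g => h (rest g) - h (rest g :\ g))).
  by rewrite -restE; ring.
by move=> g; rewrite in_setD1 => /andP[/negPf ->].
Qed.

Lemma sum_sqr_le (T : finType) (S : {set T}) (a : T -> R) :
  (\sum_(i in S) a i) ^+ 2 <= #|S|%:R * \sum_(i in S) a i ^+ 2.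
Proof.
have h : \sum_(i in S) \sum_(j in S) a i * a j <=
    \sum_(i in S) \sum_(j in S) (1 / 2 * a i ^+ 2 + 1 / 2 * a j ^+ 2).
  apply: ler_sum => i _; apply: ler_sum => j _.
  by have := sqr_ge0 (a i - a j); rewrite sqrrB; lra.
rewrite expr2 mulr_suml; under eq_bigr do rewrite mulr_sumr.
apply: le_trans h _; rewrite le_eqVlt; apply/orP; left; apply/eqP.
under eq_bigr do rewrite big_split /= sumr_const -mulr_sumr.
rewrite big_split /= sumr_const sumrMnl -mulr_sumr [RHS]mulr_natl -mulrnDl.
by congr (_ *+ _); lra.
Qed.

Variable x : R.
Hypothesis x01 : 0 <= x <= 1.
Local Notation n := (#|V|%:R : R).
Local Notation boundary_sum := (boundary_sum E x).

Lemma lambda_C0 : lambda_ x (C0 e) = boundary_sum set0.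
Proof. by apply: eq_bigl => A; rewrite in_C0. Qed.

Lemma sum_psi (phi : {set {set V}} -> R) :
  \sum_(A in W) psi e R A * phi A = n * (\sum_(A in C0 e) phi A)
    + 2 * \sum_(S : {set V} | #|S| == 2%N)
            \sum_(A : {set {set V}} | (A \subset E) && (boundary A == S)) phi A.
Proof.
rewrite (bigID (fun A => A \in C0 e)) /=; congr (_ + _).
  rewrite mulr_sumr; apply: eq_big => A; first by rewrite andb_idl // => /C0_W.
  by case/andP=> _ A0; rewrite /psi A0.
rewrite mulr_sumr (partition_big (@boundary V) (fun S => #|S| == 2%N)) /=.
  apply: eq_bigr => S /eqP S2; rewrite mulr_sumr; apply: eq_big => A.
    rewrite in_W in_C0; case: (A \subset E) => //=.
    case: (boundary A =P S) => [->|_]; last by rewrite !andbF.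
    by rewrite -cards_eq0 S2.
  by case/andP => /andP[_ /negPf A0] _; rewrite /psi A0.
move=> A; rewrite in_W in_C0; case: (A \subset E) => //=.
by rewrite -cards_eq0; case: (#|_| == 0%N); case: (#|_| == 2%N).
Qed.

(** By [boundary_sum_le] the Eulerian part contributes at most [n], and each of
    the pairs of odd vertices at most 2, times [boundary_sum set0]; and
    [n + 2 * 'C(n, 2) = n ^ 2]. *)
Lemma sum_psi_shift_le (M : {set {set V}}) : M \subset E ->
  \sum_(D in W) psi e R D * x ^+ #|symd D M| <= n ^+ 2 * boundary_sum set0.
Proof.
move=> ME; rewrite sum_psi.
have l0 : \sum_(D in C0 e) x ^+ #|symd D M| <= boundary_sum set0.
  rewrite (eq_bigl (fun D => (D \subset E) && (boundary D == set0))).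
    by rewrite boundary_sum_shift // boundary_sum_le.
  by move=> D; rewrite in_C0.
have l2 : \sum_(S : {set V} | #|S| == 2%N)
    \sum_(D : {set {set V}} | (D \subset E) && (boundary D == S)) x ^+ #|symd D M|
    <= 'C(#|V|, 2)%:R * boundary_sum set0.
  rewrite -card_draws -sum1_card natr_sum mulr_suml.
  rewrite (eq_bigl (fun S => S \in [set S : {set V} | #|S| == 2%N])).
    by apply: ler_sum => S _; rewrite boundary_sum_shift // mul1r boundary_sum_le.
  by move=> S; rewrite inE.
have n0 : 0 <= n by rewrite ler0n.
apply: le_trans (lerD (ler_wpM2l n0 l0) (ler_wpM2l (ler0n _ 2) l2)) _.
rewrite !mulrA -mulrDl le_eqVlt; apply/orP; left; apply/eqP; congr (_ * _).
rewrite -natrM -natrX -natrD; congr (_%:R).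
by rewrite -mul_bin_diag bin1; case: #|V| => // k; rewrite -mulnS.
Qed.

Section Flow.
Variable f : {set {set V}} -> R.
Let jump (A : {set {set V}}) (g : {set V}) : R := (f A - f (symd A [set g])) ^+ 2.

Let x_ge0 : 0 <= x. Proof. by case/andP: x01. Qed.

Let jump_ge0 A g : 0 <= jump A g. Proof. exact: sqr_ge0. Qed.

Let psi_ge0 D : 0 <= psi e R D.
Proof. by rewrite /psi; case: ifP; rewrite ?ler0n. Qed.

(** Cauchy-Schwarz along the path from [D + F] to [F]: removing [g] from
    [rest g] moves the chain from [rest g + F] to [rest g + F + g]. *)
Lemma path_energy_le D F rest : D \in W -> F \in C0 e -> dismantles D rest ->
  (f (symd D F) - f F) ^+ 2
  <= #|E|%:R * \sum_(g in D) jump (symd (rest g) F) g.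
Proof.
move=> DW F0 [rD rE].
have := rE (fun X => f (symd X F)); rewrite [symd set0 F]symdC symd0 => ->.
apply: le_trans (sum_sqr_le _ _) _.
apply: ler_pM; rewrite ?ler0n ?ler_nat ?subset_leq_card ?W_sub //.
  by apply: sumr_ge0 => g _; exact: sqr_ge0.
apply: ler_sum => g gD; rewrite /jump.
have [gr _ _ _] := rD g gD.
by rewrite -symdA (symdC F) symdA symd_set1D.
Qed.

(** The sum over [F] becomes a sum over the configuration [A = rest g + F] in
    which [g] is flipped. *)
Lemma edge_load_le D g rest : dismantles D rest -> g \in D ->
  \sum_(F in C0 e) x ^+ #|symd D F| * x ^+ #|F| * jump (symd (rest g) F) g
  <= \sum_(A in W | symd A [set g] \in W)
        x ^+ #|g |: A| * x ^+ #|symd D (g |: A)| * jump A g.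
Proof.
move=> [rD _] gD; have [gr rsub rW rgW] := rD g gD.
rewrite (reindex_inj (inv_inj (symdKl (rest g)))) /=.
rewrite [leRHS]big_mkcond [leLHS]big_mkcond /=; apply: ler_sum => A _.
case: ifP => [F0|_]; last first.
  by case: ifP => // _; apply: mulr_ge0 => //; rewrite mulr_ge0 ?exprn_ge0.
have -> : A \in W by rewrite -(symdKl (rest g) A) symd_W.
have -> : symd A [set g] \in W.
  rewrite -(symdKl (rest g) A) symdC symdA [symd [set g] _]symdC.
  by rewrite symd_W // symd_set1D.
rewrite /= symdKl -!exprD [leRHS](_ : _ =
  x ^+ (#|symd D (g |: A)| + #|g |: A|) * jump A g); last by rewrite addnC.
(* outside D both sides see A, inside D both exponents count each edge once *)
rewrite le_eqVlt; apply/orP; left; apply/eqP.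
congr (x ^+ _ * _); apply: card_symd_swap; apply/setP => f'.
rewrite !inE; have := fintype.subsetP rsub f'.
have [->|_] := eqVneq f' g; first by rewrite (fintype.subsetP rsub _ gr).
by case: (f' \in D); case: (f' \in rest g); case: (f' \in A) => //= /(_ isT).
Qed.

(** For each [D] the pairs [(I, F)] with [I + F = D] are handled together; the
    last sum, over [D] for a given move, is [sum_psi_shift_le]. *)
Lemma flow_bound :
  \sum_(F in C0 e) \sum_(I in W)
     psi e R I * x ^+ #|I| * x ^+ #|F| * (f I - f F) ^+ 2
  <= #|E|%:R * n ^+ 2 * boundary_sum set0 *
     \sum_(g in E) \sum_(A in W | symd A [set g] \in W)
        x ^+ #|g |: A| * jump A g.
Proof.
have m0 : 0 <= #|E|%:R :> R by rewrite ler0n.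
have /choice[rest restP] : forall D, exists r, D \in W -> dismantles D r.
  move=> D; have [DW|DW] := boolP (D \in W).
    by have [r rP] := exists_dismantling DW; exists r.
  by exists (fun=> set0).
apply: (@le_trans _ _ (#|E|%:R * \sum_(D in W) \sum_(g in D) psi e R D *
    \sum_(F in C0 e) x ^+ #|symd D F| * x ^+ #|F| * jump (symd (rest D g) F) g)).
  (* I = D + F, and psi I = psi D because F is Eulerian *)
  rewrite (eq_bigr (fun F => \sum_(D in W) psi e R D * x ^+ #|symd D F|
     * x ^+ #|F| * (f (symd D F) - f F) ^+ 2)); last first.
    move=> F F0; rewrite (reindex_inj (inv_inj (@symdK _ F))) /=.
    apply: eq_big => D; first by rewrite symd_W.
    by move=> _; rewrite /psi symd_C0.
  rewrite exchange_big /= mulr_sumr; apply: ler_sum => D DW.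
  under [X in _ <= _ * X]eq_bigr do rewrite mulr_sumr.
  rewrite [X in _ <= _ * X]exchange_big /= mulr_sumr; apply: ler_sum => F F0.
  apply: (@le_trans _ _ (psi e R D * x ^+ #|symd D F| * x ^+ #|F| *
    (#|E|%:R * \sum_(g in D) jump (symd (rest D g) F) g))).
    apply: ler_wpM2l; first by rewrite !mulr_ge0 ?exprn_ge0.
    exact: path_energy_le (restP D DW).
  rewrite mulrCA ler_wpM2l // mulr_sumr le_eqVlt; apply/orP; left; apply/eqP.
  by apply: eq_bigr => g _; rewrite !mulrA.
rewrite -[X in _ <= X * _]mulrA -[leRHS]mulrA ler_wpM2l //.
apply: (@le_trans _ _ (\sum_(D in W) \sum_(g in E) psi e R D *
   \sum_(A in W | symd A [set g] \in W)
        x ^+ #|g |: A| * x ^+ #|symd D (g |: A)| * jump A g)).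
  apply: ler_sum => D DW.
  rewrite [leRHS](big_setID D) /= -[leLHS]addr0; apply: lerD.
    rewrite (setIidPr (W_sub DW)); apply: ler_sum => g gD.
    by apply: ler_wpM2l => //; apply: edge_load_le (restP D DW) gD.
  apply: sumr_ge0 => g _; rewrite mulr_ge0 //; apply: sumr_ge0 => A _.
  by apply: mulr_ge0 => //; rewrite mulr_ge0 ?exprn_ge0.
rewrite exchange_big /= mulr_sumr; apply: ler_sum => g gE.
under eq_bigr do rewrite mulr_sumr.
rewrite exchange_big /= mulr_sumr; apply: ler_sum => A /andP[AW AgW].
rewrite (eq_bigr (fun D => (x ^+ #|g |: A| * jump A g)
   * (psi e R D * x ^+ #|symd D (g |: A)|))).
  rewrite -mulr_sumr mulrC; apply: ler_wpM2r.
    by apply: mulr_ge0; [exact: exprn_ge0 | exact: jump_ge0].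
  by apply: sum_psi_shift_le; rewrite subUset sub1set gE W_sub.
move=> D _.
have aux (p a b c : R) : p * (a * b * c) = a * c * (p * b) by ring.
exact: aux.
Qed.
End Flow.
End Worm.

(** * The worm chain *)

Section WormChain.
Set Implicit Arguments.
Unset Strict Implicit.
Import mathcomp.boot.finset.
Local Open Scope set_scope.
Variables (R : realType) (V : finType) (e : rel V).
Hypotheses (e_sym : symmetric e) (e_irr : irreflexive e).
Implicit Types (u v w : V) (g : {set V}).
Variable x : R.
Hypothesis x01 : 0 < x <= 1.
Hypothesis m_ge1 : (1 <= #|edges e|)%N.

Local Notation E := (edges e).
Local Notation W := (worm_config e).
Local Notation n := (#|V|%:R : R).
Local Notation Delta := ((max_deg e)%:R : R).
Local Notation Z := (#|V|%:R * lambda_ x (C0 e) + 2 * lambda_ x (C2 e)).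
Local Notation mu := (@ps_measure V e R x).
Local Notation d u := ((deg e u)%:R : R).
Implicit Types A B C : worm_state e.

Let x_gt0 : 0 < x. Proof. by case/andP: x01. Qed.
Let x_le1 : x <= 1. Proof. by case/andP: x01. Qed.
Let x_ge0 : 0 <= x. Proof. exact/ltW. Qed.
Let x01' : 0 <= x <= 1. Proof. by rewrite x_ge0. Qed.

Lemma exists_adj : exists u v, e u v.
Proof.
by have /card_gt0P[g /edgeP[u [v [uv _]]]] := m_ge1; exists u, v.
Qed.

Lemma card_V_gt1 : (1 < #|V|)%N.
Proof.
have [u [v uv]] := exists_adj.
apply: leq_trans (max_card [set u; v]).
by rewrite cards2 (edge_neq e_irr uv).
Qed.

Lemma n_gt0 : 0 < n.
Proof. by rewrite ltr0n ltnW // card_V_gt1. Qed.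

Lemma deg_le u : d u <= Delta.
Proof. by rewrite ler_nat; apply: leq_bigmax. Qed.

Lemma deg_gt0 u v : e u v -> 0 < d u.
Proof. by move=> uv; rewrite ltr0n; apply/card_gt0P; exists v; rewrite inE. Qed.

Lemma max_deg_gt0 : 0 < Delta.
Proof. have [u [v uv]] := exists_adj; exact: lt_le_trans (deg_gt0 uv) (deg_le u). Qed.

Lemma lambda_C0_gt0 : 0 < lambda_ x (C0 e).
Proof.
rewrite /lambda_ (bigD1 set0) /=; last by rewrite in_C0 sub0set boundary0 eqxx.
by rewrite cards0 expr0 ltr_wpDr // sumr_ge0 // => A _; rewrite exprn_ge0.
Qed.

Lemma Z_gt0 : 0 < Z.
Proof.
rewrite ltr_wpDr // ?mulr_gt0 ?n_gt0 ?lambda_C0_gt0 // mulr_ge0 // sumr_ge0 // => A _.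
by rewrite exprn_ge0.
Qed.

Lemma psi_gt0 (A : {set {set V}}) : 0 < psi e R A.
Proof. by rewrite /psi; case: ifP => _; rewrite ?n_gt0. Qed.

Lemma ps_measure_gt0 A : 0 < mu A.
Proof. by rewrite /ps_measure divr_gt0 ?Z_gt0 // mulr_gt0 ?psi_gt0 ?exprn_gt0. Qed.

Lemma Z_sum : Z = \sum_(A in W) psi e R A * x ^+ #|A|.
Proof.
rewrite sum_psi //; congr (_ * _ + 2 * _).
rewrite /lambda_ (partition_big (@boundary V) (fun S => #|S| == 2%N)) /=; last first.
  by move=> A; rewrite in_C2 => /andP[].
apply: eq_bigr => S S2; apply: eq_bigl => A; rewrite in_C2 -andbA.
by congr (_ && _); case: (boundary A =P S) => [->|]; rewrite ?S2 ?andbF.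
Qed.

Lemma ps_measure_sum : \sum_A mu A = 1.
Proof.
rewrite -mulr_suml -(big_sub W (fun A : {set {set V}} => x ^+ #|A| * psi e R A)).
by under eq_bigr do rewrite mulrC; rewrite -Z_sum divff // gt_eqF // Z_gt0.
Qed.

Lemma flipE (A : {set {set V}}) u v : flip A u v = symd A [set [set u; v]].
Proof. by []. Qed.

Lemma flip_sym (A : {set {set V}}) u v : flip A u v = flip A v u.
Proof. by rewrite !flipE setUC. Qed.

Lemma flip_flip (A : {set {set V}}) u v : flip (flip A u v) u v = A.
Proof. by rewrite !flipE symdK. Qed.

(** The closed form of the stationary flow [mu A * worm_P x A B] along [uv], in
    which exchanging [(A, u)] with [(B, v)] is visibly a symmetry. *)
Definition edge_flow A B u v : R :=
  (2 * Z)^-1 * (if (val A \in C0 e) || (val B \in C0 e)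
    then x ^+ #|[set u; v] |: val A| * ((d u)^-1 + (d v)^-1)
    else Num.min (x ^+ #|val A| / d u) (x ^+ #|val B| / d v)).

Lemma setU1_flip (A : {set {set V}}) u v :
  [set u; v] |: flip A u v = [set u; v] |: A.
Proof.
apply/setP => g; rewrite !in_setU1 flipE in_symd in_set1.
by case: eqP => // _; rewrite addbF.
Qed.

Lemma edge_flow_sym A B u v : val B = flip (val A) u v ->
  edge_flow A B u v = edge_flow B A v u.
Proof.
move=> AB; rewrite /edge_flow orbC minC (addrC (d v)^-1).
by rewrite [[set v; u]]setUC AB setU1_flip.
Qed.

Lemma expr_card_flip (A : {set {set V}}) u v :
  x ^+ #|A| * x ^+ ([set u; v] \notin A) = x ^+ #|[set u; v] |: A|.
Proof. by rewrite -exprD cardsU1 addnC. Qed.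

Lemma expr_card_flipz (A : {set {set V}}) u v :
  x ^+ #|A| * x ^ (([set u; v] \notin A)%:Z - ([set u; v] \in A)%:Z)
  = x ^+ #|flip A u v|.
Proof.
rewrite flipE; have [gA|gA] := boolP ([set u; v] \in A).
  rewrite symd_set1D // [in LHS](cardsD1 [set u; v]) gA /= add1n exprSr.
  by rewrite sub0r exprN1 mulfK // gt_eqF.
by rewrite symd_set1U // cardsU1 gA /= subr0 exprSr expr1z.
Qed.

Lemma ps_flow A B u v : e u v -> val B = flip (val A) u v ->
  (val A \in C2 e -> val B \in C2 e -> u \in boundary (val A)) ->
  mu A * worm_P x A B = edge_flow A B u v.
Proof.
move=> uv AB hu; have Z0 := Z_gt0; have n0 := n_gt0.
have vu : e v u by rewrite e_sym.
have du := deg_gt0 uv; have dv := deg_gt0 vu.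
have nz : [&& Z != 0, n != 0, d u != 0 & d v != 0] by rewrite !gt_eqF.
case/and4P: nz => Zn nn dun dvn.
have z0 : 0 <= (2 * Z)^-1 by rewrite invr_ge0 mulr_ge0 // ltW.
have c0 : 0 <= x ^+ #|val A| * 2 / Z / (4 * d u).
  by rewrite !divr_ge0 ?mulr_ge0 ?exprn_ge0 // ltW.
rewrite /edge_flow /ps_measure -expr_card_flip.
have [A0|A0] := boolP (val A \in C0 e).
  rewrite (worm_P_from_C0 _ e_irr uv AB A0) /psi A0 [LHS]/=.
  have aux (z a b y t N : R) : z != 0 -> a != 0 -> b != 0 -> N != 0 ->
      y * N / z * (t * (1 / (2 * N)) * (1 / a + 1 / b))
      = (2 * z)^-1 * (y * t * (a^-1 + b^-1)).
    by move=> zn an bn Nn; field; rewrite zn an bn Nn.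
  exact: aux.
rewrite /psi (negPf A0).
have [B0|B0] := boolP (val B \in C0 e).
  rewrite (worm_P_to_C0 _ e_irr uv AB B0) [LHS]/=.
  have aux (z a b y t : R) : z != 0 -> a != 0 -> b != 0 ->
      y * 2 / z * (t * (1 / 4) * (1 / a + 1 / b))
      = (2 * z)^-1 * (y * t * (a^-1 + b^-1)).
    by move=> zn an bn; field; rewrite zn an bn.
  exact: aux.
have A2 := worm_state_C2 A0; have B2 := worm_state_C2 B0.
rewrite (worm_P_C2 _ e_irr uv AB A2 B2 (hu A2 B2)) AB -expr_card_flipz [LHS]/=.
have aux (z a b y t : R) : z != 0 -> a != 0 -> b != 0 -> 0 <= (2 * z)^-1 ->
    0 <= y * 2 / z / (4 * a) ->
    y * 2 / z * (Num.min (a / b * t) 1 * (1 / (4 * a)))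
    = (2 * z)^-1 * Num.min (y / a) (y * t / b).
  move=> zn an bn z1 y0.
  rewrite [LHS](_ : _ = y * 2 / z / (4 * a) * Num.min (a / b * t) 1).
    rewrite minr_pMr // minr_pMr // minC.
    by congr Num.min; field; rewrite ?zn ?an ?bn.
  by move: (Num.min _ _) => k; field; rewrite zn an.
exact: aux.
Qed.

(** Exactly one end of the flipped edge is odd in [A] when [A] and [B] both have
    two odd vertices, and then the other end is odd in [B]. *)
Lemma orient_edge A B u v : e u v -> val B = flip (val A) u v ->
  exists u' v', [/\ e u' v', [set u'; v'] = [set u; v], val B = flip (val A) u' v',
    (val A \in C2 e -> val B \in C2 e -> u' \in boundary (val A)) &
    (val B \in C2 e -> val A \in C2 e -> v' \in boundary (val B))].
Proof.
move=> uv AB; have vu : e v u by rewrite e_sym.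
have uNv := edge_neq e_irr uv.
have [A2|A2] := boolP (val A \in C2 e); last first.
  by exists u, v; split=> // ; case/negP: A2.
have [B2|B2] := boolP (val B \in C2 e); last first.
  by exists u, v; split=> // ; case/negP: B2.
have cA := card_boundary_C2 A2; have cB := card_boundary_C2 B2.
have bB : boundary (val B) = symd (boundary (val A)) [set u; v].
  by rewrite AB flipE boundary_symd boundary1.
have uB : (u \in boundary (val B)) = (u \notin boundary (val A)).
  by rewrite bB in_symd set21 addbT.
have vB : (v \in boundary (val B)) = (v \notin boundary (val A)).
  by rewrite bB in_symd set22 addbT.
have cI : #|boundary (val A) :&: [set u; v]| = 1%N.
  have := card_symd (boundary (val A)) [set u; v].
  rewrite -bB cA cB cards2 uNv => /eqP.
  by rewrite -[(2 + _)%N in X in _ == X]/(2 + 1.*2)%N eqn_add2l => /eqP/double_inj.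
have [uA|uA] := boolP (u \in boundary (val A)).
  exists u, v; split=> // _ _; rewrite vB; apply/negP => vA.
  move: cI; rewrite (setIidPr _) ?cards2 ?uNv //.
  by apply/fintype.subsetP => w; rewrite in_set2 => /orP[] /eqP ->.
exists v, u; split=> //; first by rewrite setUC.
- by rewrite flip_sym.
- move=> _ _; have /card_gt0P[w] : (0 < #|boundary (val A) :&: [set u; v]|)%N by rewrite cI.
  rewrite in_setI in_set2 => /andP[wA /orP[] /eqP wE]; last by rewrite -wE.
  by rewrite -wE wA in uA.
- by move=> _ _; rewrite uB.
Qed.

(** In every case of [edge_flow] the degrees are at most [Delta] and the powers
    of [x] at least that of the larger configuration. *)
Lemma ps_flow_ge A B g : g \in E -> val B = symd (val A) [set g] ->
  x ^+ #|g |: val A| / (2 * Delta * Z) <= mu A * worm_P x A B.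
Proof.
move=> /edgeP[u0 [v0 [uv0 ->]]]; rewrite -flipE => AB0.
have [u [v [uv <- AB hu _]]] := orient_edge uv0 AB0.
have vu : e v u by rewrite e_sym.
have du := deg_gt0 uv; have dv := deg_gt0 vu; have Z0 := Z_gt0.
have D0 : 0 < Delta := lt_le_trans du (deg_le u).
have xk k : 0 <= x ^+ k by rewrite exprn_ge0.
have iu : Delta^-1 <= (d u)^-1 by rewrite lef_pV2 ?posrE ?deg_le.
have iv : Delta^-1 <= (d v)^-1 by rewrite lef_pV2 ?posrE ?deg_le.
have i0 : 0 <= Delta^-1 by rewrite invr_ge0 ltW.
rewrite (ps_flow uv AB hu) /edge_flow.
rewrite [leLHS](_ : _ = (2 * Z)^-1 * (x ^+ #|[set u; v] |: val A| * Delta^-1)); last first.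
  have aux (z D y : R) : 0 < z -> 0 < D -> y / (2 * D * z) = (2 * z)^-1 * (y * D^-1).
    by move=> z1 D1; field; rewrite !gt_eqF.
  exact: aux.
rewrite ler_wpM2l ?invr_ge0 ?mulr_ge0 ?(ltW Z0) //.
case: ifP => _; first by rewrite ler_wpM2l //; have := ltW dv; lra.
have xA : x ^+ #|[set u; v] |: val A| <= x ^+ #|val A|.
  by rewrite ler_wiXn2l // subset_leq_card // subsetUr.
have xB : x ^+ #|[set u; v] |: val A| <= x ^+ #|val B|.
  by rewrite ler_wiXn2l // AB -(setU1_flip (val A)) subset_leq_card // subsetUr.
by rewrite le_min !ler_pM.
Qed.

Lemma worm_offdiag_ge0 (A B : {set {set V}}) : 0 <= worm_offdiag e x A B.
Proof.
rewrite /worm_offdiag; case: pickP => // [[u v]] _.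
have xk k : 0 <= x ^+ k by rewrite exprn_ge0.
have xz (k : int) : 0 <= x ^ k by rewrite exprz_ge0.
rewrite /worm_rate; case: ifP => _; last case: ifP => _.
- by rewrite !mulr_ge0 ?addr_ge0 ?divr_ge0 ?mulr_ge0.
- by rewrite !mulr_ge0 ?addr_ge0 ?divr_ge0 ?mulr_ge0.
- by rewrite mulr_ge0 ?divr_ge0 ?mulr_ge0 // le_min ler01 andbT !mulr_ge0 ?invr_ge0.
Qed.

(** An upper bound for the part of the rate out of [A] that is due to a worm end
    at [u] moving along a given edge; the total over all [u] and their edges is
    at most 1/2. *)
Definition exit_rate (A : {set {set V}}) u : R :=
  if A \in C0 e then (2 * n * d u)^-1
  else if u \in boundary A then (4 * d u)^-1 else 0.

Lemma exit_rate_ge0 A u : 0 <= exit_rate (val A) u.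
Proof.
by rewrite /exit_rate; case: ifP => _; last case: ifP => // _; rewrite invr_ge0 !mulr_ge0.
Qed.

(** A move from or to an Eulerian configuration is proposed from both ends of
    the edge, hence the sum over both orientations. *)
Lemma worm_offdiag_le A B : A != B -> worm_offdiag e x (val A) (val B) <=
  \sum_(uv : V * V | e uv.1 uv.2 && (val B == flip (val A) uv.1 uv.2)) exit_rate (val A) uv.1.
Proof.
move=> nAB; rewrite /worm_offdiag; case: pickP => [[u v] /=|_]; last first.
  by apply: sumr_ge0 => uv _; exact: exit_rate_ge0.
case/and3P=> uv AB hu; have vu : e v u by rewrite e_sym.
have uNv := edge_neq e_irr uv.
have du := deg_gt0 uv; have dv := deg_gt0 vu; have n0 := n_gt0.
have r0 w := exit_rate_ge0 A w.
have one : exit_rate (val A) u <=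
  \sum_(uv : V * V | e uv.1 uv.2 && (val B == flip (val A) uv.1 uv.2)) exit_rate (val A) uv.1.
  by rewrite (bigD1 (u, v)) /= ?uv ?AB // lerDl sumr_ge0.
have two : exit_rate (val A) u + exit_rate (val A) v <=
  \sum_(uv : V * V | e uv.1 uv.2 && (val B == flip (val A) uv.1 uv.2)) exit_rate (val A) uv.1.
  rewrite (bigD1 (u, v)) /= ?uv ?AB // lerD2l (bigD1 (v, u)) /= ?lerDl ?sumr_ge0 //.
  by rewrite vu flip_sym AB /=; apply/eqP => -[vu_eq _]; rewrite vu_eq eqxx in uNv.
have xb (b : bool) : x ^+ b <= 1 by case: b; rewrite ?expr1 ?expr0.
have xb0 (b : bool) : 0 <= x ^+ b by rewrite exprn_ge0.
have drop (t p q : R) : t <= 1 -> 0 <= p * q -> t * p * q <= p * q.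
  by move=> t1 pq; rewrite -mulrA ler_piMl.
rewrite /worm_rate -(eqP AB).
have [A0|A0] := boolP (val A \in C0 e).
  apply: le_trans two; rewrite /exit_rate A0; apply: le_trans (drop _ _ _ (xb _) _) _.
    by rewrite mulr_ge0 ?addr_ge0 ?divr_ge0 ?mulr_ge0.
  rewrite le_eqVlt; apply/orP; left; apply/eqP.
  have aux (N a b : R) : 0 < N -> 0 < a -> 0 < b ->
      1 / (2 * N) * (1 / a + 1 / b) = (2 * N * a)^-1 + (2 * N * b)^-1.
    by move=> N0 a0 b0; field; rewrite !gt_eqF.
  exact: aux.
have A2 := worm_state_C2 A0.
have rE w : w \in boundary (val A) -> exit_rate (val A) w = (4 * d w)^-1.
  by move=> wA; rewrite /exit_rate (negPf A0) wA.
have [B0|B0] := boolP (val B \in C0 e).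
  have bA : boundary (val A) = [set u; v].
    rewrite -[LHS](symdK [set u; v]) -{1}[[set u; v]]boundary1 -boundary_symd -flipE -(eqP AB).
    by move: B0; rewrite in_C0 => /andP[_ /eqP ->]; rewrite symdC symd0.
  apply: le_trans two; rewrite !rE ?bA ?set21 ?set22 //.
  apply: le_trans (drop _ _ _ (xb _) _) _.
    by rewrite mulr_ge0 ?addr_ge0 ?divr_ge0.
  rewrite le_eqVlt; apply/orP; left; apply/eqP.
  have aux (a b : R) : 0 < a -> 0 < b ->
      1 / 4 * (1 / a + 1 / b) = (4 * a)^-1 + (4 * b)^-1.
    by move=> a0 b0; field; rewrite !gt_eqF.
  exact: aux.
have B2 := worm_state_C2 B0.
apply: le_trans one; rewrite rE ?div1r; last by move: hu; rewrite A2 B2.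
by rewrite ler_piMl ?invr_ge0 ?mulr_ge0 // ge_min lexx orbT.
Qed.

Lemma worm_lazy A : 1 / 2 <= worm_P x A A.
Proof.
rewrite /worm_P eqxx.
suff : \sum_(C | C != A) worm_offdiag e x (val A) (val C) <= 1 / 2 by lra.
apply: (@le_trans _ _ (\sum_(C : worm_state e) \sum_(uv : V * V |
    e uv.1 uv.2 && (val C == flip (val A) uv.1 uv.2)) exit_rate (val A) uv.1)).
  rewrite big_mkcond /=; apply: ler_sum => C _; case: ifP => [CA|_].
    by apply: worm_offdiag_le; rewrite eq_sym.
  by apply: sumr_ge0 => uv _; exact: exit_rate_ge0.
have -> : \sum_(C : worm_state e) \sum_(uv : V * V |
    e uv.1 uv.2 && (val C == flip (val A) uv.1 uv.2)) exit_rate (val A) uv.1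
  = \sum_(uv : V * V | e uv.1 uv.2) \sum_(C : worm_state e | val C == flip (val A) uv.1 uv.2)
      exit_rate (val A) uv.1.
  rewrite (exchange_big_dep (fun uv : V * V => e uv.1 uv.2)) /=; last by move=> C uv _ /andP[].
  by apply: eq_bigr => uv euv; apply: eq_bigl => C; rewrite euv.
apply: (@le_trans _ _ (\sum_(uv : V * V | e uv.1 uv.2) exit_rate (val A) uv.1)).
  apply: ler_sum => uv _.
  have [/existsP[C0 /eqP C0E]|/existsPn no] := boolP
    [exists C : worm_state e, val C == flip (val A) uv.1 uv.2].
    by rewrite (big_pred1 C0) // => C; rewrite /= -C0E (inj_eq val_inj).
  by rewrite big_pred0 ?exit_rate_ge0 // => C; apply/negbTE/no.
rewrite -(pair_big_dep xpredT (fun u v => e u v) (fun u _ => exit_rate (val A) u)) /=.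
have degE u : \sum_(v | e u v) exit_rate (val A) u = exit_rate (val A) u * d u.
  by rewrite sumr_const mulr_natr /deg cardsE.
under eq_bigr do rewrite degE.
have cancel (a : R) u : 0 <= a -> (a * d u)^-1 * d u <= a^-1.
  move=> a0; have [->|du] := eqVneq (d u) 0; first by rewrite mulr0 invr_ge0.
  by rewrite invfM mulfVK.
have n0 := n_gt0.
have [A0|A0] := boolP (val A \in C0 e).
  apply: (@le_trans _ _ (\sum_(u : V) (2 * n)^-1)).
    by apply: ler_sum => u _; rewrite /exit_rate A0 cancel ?mulr_ge0.
  rewrite sumr_const -[leLHS]mulr_natl le_eqVlt; apply/orP; left; apply/eqP.
  by field; rewrite gt_eqF.
have cA := card_boundary_C2 (worm_state_C2 A0).
apply: (@le_trans _ _ (\sum_(u in boundary (val A)) 4^-1)).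
  rewrite [leRHS]big_mkcond /=; apply: ler_sum => u _; rewrite /exit_rate (negPf A0).
  by case: ifP => _; rewrite ?mul0r ?cancel.
by rewrite sumr_const cA; lra.
Qed.

Lemma worm_rev A B :
  mu A * worm_P x A B = mu B * worm_P x B A.
Proof.
have [->//|nAB] := eqVneq A B.
have [/existsP[[u v] /= /andP[uv /eqP AB]]|/existsPn no] := boolP
   [exists uv : V * V, e uv.1 uv.2 && (val B == flip (val A) uv.1 uv.2)]; last first.
  rewrite !worm_P_eq0 ?mulr0 // 1?eq_sym // => u v uv; have := no (u, v); rewrite /= uv //=.
  by apply: contra => /eqP ->; rewrite flip_flip.
have [u' [v' [uv' _ AB' hA hB]]] := orient_edge uv AB.
have vu' : e v' u' by rewrite e_sym.
have BA' : val A = flip (val B) v' u' by rewrite AB' flip_sym flip_flip.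
by rewrite (ps_flow uv' AB' hA) (ps_flow vu' BA' hB) edge_flow_sym.
Qed.

Lemma worm_lazy_reversible : lazy_reversible (worm_P x) mu.
Proof.
split; [exact: ps_measure_gt0|exact: ps_measure_sum| |exact: worm_P_sum
       |exact: worm_rev|exact: worm_lazy].
move=> A B; have [->|nAB] := eqVneq A B; first by apply: le_trans (worm_lazy B); lra.
by rewrite /worm_P (negPf nAB) worm_offdiag_ge0.
Qed.

(** [flow_bound] is about functions on all edge sets; this brings functions on
    the states into its scope. *)
Definition extend (f : worm_state e -> R) (A : {set {set V}}) : R :=
  f (insubd (worm0 e) A).

Lemma extendE f A : extend f (val A) = f A.
Proof. by rewrite /extend valKd. Qed.

(** Distinct edges lead from [A] to distinct configurations, so the sum over the
    edges is part of the double sum that defines the Dirichlet form. *)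
Lemma sum_edges_le_dirichlet (f : worm_state e -> R) :
  \sum_(g in E) \sum_(A in W | symd A [set g] \in W)
     x ^+ #|g |: A| * (extend f A - extend f (symd A [set g])) ^+ 2
  <= 4 * Delta * Z * dirichlet (worm_P x) mu f.
Proof.
pose f' := extend f; have f'E A : f' (val A) = f A := extendE f A.
rewrite -/f'.
have D0 := max_deg_gt0.
have DZ0 : 0 < 2 * Delta * Z by rewrite !mulr_gt0 ?Z_gt0.
have [pi0 _ P0 _ _ _] := worm_lazy_reversible.
rewrite (exchange_big_dep (fun A : {set {set V}} => A \in W)) /=; last by move=> g A _ /andP[].
rewrite (big_sub W (fun A : {set {set V}} => \sum_(g in E | (A \in W) && (symd A [set g] \in W)) 
   x ^+ #|g |: A| * (f' A - f' (symd A [set g])) ^+ 2)).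
rewrite /dirichlet [leRHS](_ : _ = (2 * Delta * Z) * \sum_A \sum_B
   mu A * worm_P x A B * (f A - f B) ^+ 2); last by lra.
rewrite mulr_sumr; apply: ler_sum => A _.
pose phi (B : {set {set V}}) := (2 * Delta * Z) *
  (mu A * worm_P x A (insubd (worm0 e) B) * (f A - f' B) ^+ 2).
have -> : 2 * Delta * Z * \sum_B mu A * worm_P x A B * (f A - f B) ^+ 2 = \sum_(B in W) phi B.
  rewrite mulr_sumr (big_sub W phi); apply: eq_bigr => B _.
  by rewrite /phi f'E valKd.
have phi0 (B : {set {set V}}) : 0 <= phi B.
  by apply: mulr_ge0; [exact: ltW|rewrite mulr_ge0 ?sqr_ge0 // mulr_ge0 // ltW].
set T := [set symd (val A) [set g] | g in [set g in E | symd (val A) [set g] \in W]].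
have TW : T \subset W.
  by apply/fintype.subsetP => _ /imsetP[g + ->]; rewrite inE => /andP[].
rewrite (big_setID T) /= (setIidPr TW) -[leLHS]addr0 lerD //; last exact: sumr_ge0.
rewrite big_imset /=; last first.
  move=> g h _ _ /(congr1 (symd (val A))); rewrite !symdKl => /setP/(_ g).
  by rewrite !in_set1 eqxx => /esym/eqP.
rewrite (eq_bigl (fun g => g \in [set g in E | symd (val A) [set g] \in W])); last first.
  by move=> g; have AW : sval A \in W := valP A; rewrite [RHS]in_set AW.
apply: ler_sum => g; rewrite inE => /andP[gE gW].
rewrite /phi f'E mulrA; apply: ler_wpM2r; first exact: sqr_ge0.
rewrite -ler_pdivrMl // mulrC; apply: ps_flow_ge => //.
by rewrite insubdK.
Qed.

(** The mean square distance of [f] from any of its values is at least the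
    variance, so comparing each [I] with the Eulerian [F] only is enough. *)
Lemma worm_poincare (f : worm_state e -> R) :
  avg mu f = 0 ->
  avg mu (fun A => f A ^+ 2)
  <= 4 * Delta * #|E|%:R * n ^+ 2 * dirichlet (worm_P x) mu f.
Proof.
move=> f0; pose f' := extend f; have f'E A : f' (val A) = f A := extendE f A.
have Z0 := Z_gt0; have L0 := lambda_C0_gt0; set L := lambda_ x (C0 e) in L0.
pose T := \sum_(F in C0 e) \sum_(I in W) psi e R I * x ^+ #|I| * x ^+ #|F| * (f' I - f' F) ^+ 2.
have avgE (h : {set {set V}} -> R) :
    \sum_(I in W) psi e R I * x ^+ #|I| * h I = Z * avg mu (fun A => h (val A)).
  rewrite (big_sub W (fun I : {set {set V}} => psi e R I * x ^+ #|I| * h I)) /avg mulr_sumr.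
  apply: eq_bigr => A _; rewrite /ps_measure.
  have aux (z y t k : R) : 0 < z -> t * y * k = z * (y * t / z * k).
    by move=> z0; field; rewrite gt_eqF.
  exact: aux.
have T_ge : Z * L * avg mu (fun A => f A ^+ 2) <= T.
  have aux (z l a : R) : z * l * a = l * (z * a) by ring.
  have LE : L = \sum_(F in C0 e) x ^+ #|F| by [].
  rewrite aux /T {1}LE mulr_suml.
  apply: ler_sum => F _.
  rewrite [leRHS](_ : _ = x ^+ #|F| * \sum_(I in W) psi e R I * x ^+ #|I| *
      (f' I ^+ 2 - 2 * f' F * f' I + f' F ^+ 2)); last first.
    rewrite mulr_sumr; apply: eq_bigr => I _.
    have aux2 (t y z a b : R) :
      t * y * z * (a - b) ^+ 2 = z * (t * y * (a ^+ 2 - 2 * b * a + b ^+ 2)) by ring.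
    exact: aux2.
  rewrite ler_wpM2l ?exprn_ge0 // avgE ler_wpM2l ?(ltW Z0) //.
  rewrite [leRHS](@eq_avg _ _ _ _ (fun A => f A ^+ 2 + ((- (2 * f' F)) * f A + f' F ^+ 2))).
    rewrite !avgD avgZ f0 mulr0 add0r lerDl.
    by rewrite (avg_cst worm_lazy_reversible) sqr_ge0.
  by move=> A; rewrite f'E; ring.
have T_le := flow_bound e_irr x01' f'.
rewrite -/T -lambda_C0 -/L in T_le.
have D_le := sum_edges_le_dirichlet f; rewrite -/f' in D_le.
have c0 : 0 <= #|E|%:R * n ^+ 2 * L by rewrite !mulr_ge0 ?exprn_ge0 // ltW.
have := le_trans T_ge (le_trans T_le (ler_wpM2l c0 D_le)).
rewrite [leRHS](_ : _ = Z * L * (4 * Delta * #|E|%:R * n ^+ 2 * dirichlet (worm_P x) mu f)).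
  by rewrite ler_pM2l // mulr_gt0.
have aux (k N l D z f1 : R) :
  k * N ^+ 2 * l * (4 * D * z * f1) = z * l * (4 * D * k * N ^+ 2 * f1) by ring.
exact: aux.
Qed.

(** [psi] is at most [n] as [n >= 2], and there are [2 ^ m] sets of edges. *)
Lemma Z_le : Z <= n * 2 ^+ #|E|.
Proof.
rewrite Z_sum; apply: (@le_trans _ _ (\sum_(A in powerset E) n)).
  have sub : W \subset powerset E.
    by apply/fintype.subsetP => A AW; rewrite inE W_sub.
  rewrite [leRHS](big_setID W) /= (setIidPr sub) -[leLHS]addr0.
  apply: lerD; last exact: sumr_ge0.
  apply: ler_sum => A _; rewrite -[leRHS]mulr1 ler_pM ?exprn_ge0 ?exprn_ile1 //.
    exact/ltW/psi_gt0.
  by rewrite /psi; case: ifP; rewrite ?lexx // ler_nat card_V_gt1.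
by rewrite sumr_const card_powerset -[leLHS]mulr_natr natrX.
Qed.

Lemma ps_measure_ge A : 2 / n * (x / 2) ^+ #|E| <= mu A.
Proof.
have n0 := n_gt0.
rewrite /ps_measure; apply: (@le_trans _ _ (x ^+ #|E| * 2 / (n * 2 ^+ #|E|))).
  rewrite le_eqVlt; apply/orP; left; apply/eqP.
  have k0 : 2 ^+ #|E| != 0 :> R by rewrite expf_neq0.
  have aux (N t y : R) : 0 < N -> t != 0 -> 2 / N * (y / t) = y * 2 / (N * t).
    by move=> N0 t0; field; rewrite t0 gt_eqF.
  by rewrite expr_div_n; exact: aux.
apply: ler_pM; rewrite ?mulr_ge0 ?invr_ge0 ?exprn_ge0 ?mulr_ge0 ?exprn_ge0 //.
  apply: ler_pM; rewrite ?exprn_ge0 //.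
    by rewrite ler_wiXn2l // subset_leq_card // W_sub // (valP A).
  by rewrite /psi; case: ifP => _ //; rewrite ler_nat card_V_gt1.
by rewrite lef_pV2 ?posrE ?Z_gt0 ?mulr_gt0 ?exprn_gt0 // Z_le.
Qed.

Lemma ps_measure0_ge : (2 ^+ #|E|)^-1 <= mu (worm0 e).
Proof.
have n0 := n_gt0.
rewrite /ps_measure /= cards0 expr0 mul1r /psi.
have -> : set0 \in C0 e by rewrite in_C0 sub0set boundary0 eqxx.
rewrite ler_pdivlMr ?Z_gt0 // mulrC ler_pdivrMr ?exprn_gt0 //.
exact: Z_le.
Qed.
End WormChain.


(** * Elementary estimates *)

Section Arithmetic.
Set Implicit Arguments.
Unset Strict Implicit.
Variable R : realType.

Lemma ln2_ge : 1 / 2 <= ln 2 :> R.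
Proof.
have := @le_ln1Dx R (- (1 / 2)).
rewrite (_ : 1 + - (1 / 2) = 2^-1); last by field.
by rewrite lnV ?posrE // => /(_ ltac:(lra)); lra.
Qed.

Lemma tanh_gt0_le1 (b : R) : 0 < b -> 0 < tanh b <= 1.
Proof.
move=> b0; rewrite /tanh.
have e1 : expR (- b) < expR b by rewrite ltr_expR; lra.
have p1 := expR_gt0 b; have p2 := expR_gt0 (- b).
rewrite divr_gt0 ?subr_gt0 ?addr_gt0 // ler_pdivrMr ?addr_gt0 //; lra.
Qed.

(** The factor [n ^+ 2] is used up by the rounding term 1 and by the term
    [n - 1], which comes from [ln n <= n - 1]: the difference of the two sides
    is at least [C * (n - 1) * ((n + 1) * X - 1) - 1]. *)
Lemma sqr_slack (C n X l : R) : 16 <= C -> 2 <= n -> 1 / 2 <= X ->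
  - (X + n - 1) <= l -> 1 - C * l <= C * n ^+ 2 * X.
Proof.
move=> C16 n2 X12 lX.
have a : 3 / 2 <= (n + 1) * X.
  by rewrite (_ : 3 / 2 = 3 * (1 / 2)) ?ler_pM //; lra.
have b : 1 / 2 <= (n - 1) * ((n + 1) * X - 1).
  by rewrite (_ : 1 / 2 = 1 * (1 / 2)) ?ler_pM //; lra.
have c : 8 <= C * ((n - 1) * ((n + 1) * X - 1)).
  by rewrite (_ : 8 = 16 * (1 / 2)) ?ler_pM //; lra.
have d : C * - (X + n - 1) <= C * l by rewrite ler_wpM2l //; lra.
lra.
Qed.

Lemma poincare_const_ge (D m n : R) : 1 <= D -> 1 <= m -> 2 <= n ->
  16 <= 4 * D * m * n ^+ 2.
Proof.
move=> D1 m1 n2.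
have Dm : 1 <= D * m by rewrite mulr_ege1.
have nn : 2 * 2 <= n ^+ 2 by rewrite expr2 ler_pM //; lra.
rewrite (_ : 16 = 4 * 1 * (2 * 2)); last by ring.
by rewrite -[4 * D * m]mulrA !ler_pM //; lra.
Qed.

Lemma ln_inv_gt0 (d : R) : 0 < d -> d < 1 -> 0 < ln d^-1.
Proof. by move=> d0 d1; rewrite ln_gt0 // invf_gt1. Qed.

Lemma exponent_empty_ge (m d : R) : 1 <= m -> 0 < d -> d < 1 ->
  1 / 2 <= m * ln 2 + ln d^-1.
Proof.
move=> m1 d0 d1; have := ln_inv_gt0 d0 d1; have l2 := ln2_ge.
have : 1 * ln 2 <= m * ln 2 by rewrite ler_wpM2r //; lra.
lra.
Qed.

Lemma ln_divl (d : R) : 0 < d -> ln (2 / d) = ln 2 + ln d^-1.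
Proof. by move=> d0; rewrite lnM ?posrE ?invr_gt0. Qed.

Lemma exponent_ge (m x d : R) : 1 <= m -> 0 < x -> x <= 1 -> 0 < d -> d < 1 ->
  1 / 2 <= m * ln (2 / x) + ln (2 / d).
Proof.
move=> m1 x0 x1 d0 d1; have := ln_inv_gt0 d0 d1; have l2 := ln2_ge.
have lx : 0 <= ln (2 / x) by rewrite ln_ge0 // ler_pdivlMr //; lra.
have : 0 <= m * ln (2 / x) by rewrite mulr_ge0 //; lra.
by rewrite (ln_divl d0); lra.
Qed.

Lemma ln_mass_empty_ge k (p d : R) : 0 < d -> (2 ^+ k)^-1 <= p ->
  - (k%:R * ln 2 + ln d^-1) <= ln (p * d).
Proof.
move=> d0 ps.
have pos : 0 < (2 ^+ k)^-1 * d by rewrite mulr_gt0 ?invr_gt0 ?exprn_gt0.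
apply: (@le_trans _ _ (ln ((2 ^+ k)^-1 * d))).
  rewrite lnM ?posrE ?invr_gt0 ?exprn_gt0 // !lnV ?posrE ?exprn_gt0 //.
  by rewrite lnXn // -[ln 2 *+ _]mulr_natl; lra.
have le : (2 ^+ k)^-1 * d <= p * d by rewrite ler_pM2r.
by rewrite ler_ln ?posrE ?(lt_le_trans pos).
Qed.

Lemma ln_mass_ge k (n x p d : R) : 0 < n -> 0 < x -> 0 < d ->
  2 / n * (x / 2) ^+ k <= p ->
  - (k%:R * ln (2 / x) + ln (2 / d) + n - 1) <= ln (p * d).
Proof.
move=> n0 x0 d0 ps; have x20 : 0 < x / 2 by rewrite divr_gt0.
have xn0 : 0 < (x / 2) ^+ k by rewrite exprn_gt0.
have nV : 0 < 2 / n by rewrite divr_gt0.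
have pos : 0 < 2 / n * (x / 2) ^+ k * d by apply: mulr_gt0 => //; exact: mulr_gt0.
apply: (@le_trans _ _ (ln (2 / n * (x / 2) ^+ k * d))); last first.
  have le : 2 / n * (x / 2) ^+ k * d <= p * d by rewrite ler_pM2r.
  by rewrite ler_ln ?posrE ?(lt_le_trans pos).
have ln_n : ln n <= n - 1.
  by have := @le_ln1Dx R (n - 1); rewrite [1 + _]addrC subrK; apply; lra.
have xV : ln (x / 2) = - ln (2 / x) by rewrite -invf_div lnV ?posrE ?divr_gt0.
have nE : ln (2 / n) = ln 2 - ln n by rewrite ln_divl // lnV ?posrE.
rewrite [leRHS]lnM ?posrE ?(mulr_gt0 nV xn0) // [ln (2 / n * _)]lnM ?posrE //.
rewrite nE lnXn // xV -[- _ *+ _]mulr_natl (ln_divl d0) [ln d^-1]lnV ?posrE //.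
by have := ln2_ge; lra.
Qed.

Lemma bound_rescale (D m n a b : R) : 0 < m ->
  4 * (a + b / m) * D * m ^+ 2 * n ^+ 4
  = 4 * D * m * n ^+ 2 * n ^+ 2 * (m * a + b).
Proof. by move=> m0; field; rewrite gt_eqF. Qed.

Lemma poincare_const_le (C n : R) : 16 <= C -> 2 <= n -> C <= C * n ^+ 2.
Proof. by move=> C16 n2; rewrite ler_peMr ?exprn_ege1 //; lra. Qed.

Lemma bound_ge0 (C n X : R) : 16 <= C -> 2 <= n -> 1 / 2 <= X ->
  0 <= C * n ^+ 2 * X.
Proof. by move=> C16 n2 X0; rewrite !mulr_ge0 ?exprn_ge0 //; lra. Qed.
End Arithmetic.

(** * The bounds for the worm process *)

Theorem theorem1p3 (R : realType) (V : finType) (e : rel V)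
    (e_sym : symmetric e) (e_irr : irreflexive e)
    (e_conn : forall u v : V, connect e u v)
    (m_ge1 : (1 <= #|edges e|)%N)
    (beta : R) (beta_gt0 : 0 < beta) :
  let n : R := #|V|%:R in
  let m : R := #|edges e|%:R in
  let Delta : R := (max_deg e)%:R in
  let x : R := tanh beta in
  let P : worm_state e -> worm_state e -> R := worm_P x in
  let pi : worm_state e -> R := ps_measure x in
  [/\ (trel P <= (4 * Delta * m * n ^+ 4)%:E)%E,
      forall delta : R, 0 < delta -> delta < 1 ->
        (tmix_from P pi (worm0 e) delta
          <= (4 * (ln 2 + ln (delta^-1) / m) * Delta * m ^+ 2 * n ^+ 4)%:E)%E
    & forall delta : R, 0 < delta -> delta < 1 ->
        (tmix P pi delta
          <= (4 * (ln (2 / x) + ln (2 / delta) / m)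
              * Delta * m ^+ 2 * n ^+ 4)%:E)%E].
Proof.
move=> n m Delta x P pi.
have x01 : 0 < x <= 1 := tanh_gt0_le1 beta_gt0.
have [x0 x1] := andP x01.
have n2 : 2 <= n by rewrite (ler_nat R 2) (card_V_gt1 e_irr m_ge1).
have n0 : 0 < n := n_gt0 R e_irr m_ge1.
have D1 : 1 <= Delta by rewrite ler1n -(ltr0n R) (max_deg_gt0 _ m_ge1).
have m1 : 1 <= m by rewrite ler1n.
have m0 : 0 < m := lt_le_trans ltr01 m1.
have C16 := poincare_const_ge D1 m1 n2.
have C1 : 1 < 4 * Delta * m * n ^+ 2 by rewrite (lt_le_trans _ C16) // ltr1n.
have ch := worm_lazy_reversible e_sym e_irr x01 m_ge1.
have pc := worm_poincare e_sym e_irr x01 m_ge1.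
split=> [|delta d0 d1|delta d0 d1].
- apply: le_trans (trel_le ch C1 pc) _; rewrite lee_fin.
  rewrite -[n ^+ 4]/(n ^+ (2 + 2)) exprD [leRHS]mulrA; exact: poincare_const_le.
- have X0 := exponent_empty_ge m1 d0 d1.
  rewrite bound_rescale //; apply: (tmix_from_le ch C1 pc) => //; first exact: bound_ge0.
  apply: sqr_slack => //.
  apply: le_trans (ln_mass_empty_ge d0 (ps_measure0_ge e_irr x01 m_ge1)).
  by rewrite lerN2 -addrA lerDl subr_ge0 (le_trans _ n2) // ler1n.
- have X0 := exponent_ge m1 x0 x1 d0 d1.
  rewrite bound_rescale //; have b0 := bound_ge0 C16 n2 X0.
  apply: bigmax_le => [|A _]; first by rewrite lee_fin.
  apply: (tmix_from_le ch C1 pc) => //; apply: sqr_slack => //.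
  exact: ln_mass_ge (ps_measure_ge e_irr x01 m_ge1 A).
Qed.
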